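(* Let $\Omega=\bigcup_{i=1}^nJ_i$, $J_i=(\alpha_i,\beta_i)$, with $-\infty<\alpha_1<\beta_1<\alpha_2<\beta_2<\dots<\alpha_n<\beta_n<\infty$. The vector space $\mathcal{D}_{\max}$ with the inner product $$\langle f,g\rangle_{\mathrm{graph}}=\langle f,g\rangle_{L^2(\Omega)}+\langle \mathsf{D}f,\mathsf{D}g\rangle_{L^2(\Omega)},\qquad f,g\in\mathcal{D}_{\max}$$ (called the graph inner product), where $\mathsf{D}f=\frac{1}{2\pi \mathrm{i}}f'$, is a reproducing kernel Hilbert space, so for every $x\in\overline\Omega$ there exists a unique function $k_x\in\mathcal{D}_{\max}$ such that $$\langle f,k_x\rangle_{\mathrm{graph}}=f(x)\quad\text{for all } f\in\mathcal{D}_{\max}.$$ For the endpoints we have $$k_{\alpha_i}(t)=\chi_{J_i}(t)\frac{\cosh 2\pi(\beta_i-t)}{\sinh2\pi(\beta_i-\alpha_i)},\qquad k_{\beta_i}(t)=\chi_{J_i}(t)\frac{\cosh2\pi(t-\alpha_i)}{\sinh2\pi(\beta_i-\alpha_i)}.$$ For interior points $x\in\Omega$, if $x\in J_j$, then $$k_x(t)=A_x\chi_{(\alpha_j,x]}(t)\frac{\cosh2\pi(t-\alpha_j)}{\sinh2\pi(x-\alpha_j)}+B_x\chi_{[x,\beta_j)}(t)\frac{\cosh2\pi(\beta_j-t)}{\sinh2\pi(\beta_j-x)},$$ where $A_x,B_x$ are the solutions of the system of equations $$A_x+B_x=1,\qquad A_x\coth2\pi(x-\alpha_j)-B_x\c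oth2\pi(\beta_j-x)=0.$$
   Context: $\mathcal{D}_{\max}=\{f:\Omega\to\mathbb{C}: f\text{ is absolutely continuous on each interval }J_i,\ f'\in L^2(\Omega)\}$; this is the domain of the adjoint of the operator $\frac{1}{2\pi \mathrm{i}}\frac{d}{dx}$ defined on $C_c^\infty(\Omega)$, and the adjoint acts on it by $f\mapsto\frac{1}{2\pi \mathrm{i}}f'$. Each $f\in\mathcal{D}_{\max}$ is extended to the closure $\overline\Omega$ by its one-sided limits: $f(\alpha_i)=\lim_{x\downarrow\alpha_i}f(x)$, $f(\beta_i)=\lim_{x\uparrow\beta_i}f(x)$. $L^2(\Omega)$ is taken with respect to Lebesgue measure, with inner product linear in the first variable; $\chi_S$ is the indicator function of $S$; $\sinh$, $\cosh$, $\coth$ are the hyperbolic sine, cosine and cotangent.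
   Formalization: All three kernel formulas are multiplied by the missing factor 2π (testing against χ_{J_i} shows the displayed ones fail), and in the interior formula the second indicator is χ_{(x,β_j)} instead of χ_{[x,β_j)}, so the value at t=x is not counted twice. *)

(* Defs.v *)
From HB Require Import structures.
From mathcomp Require Import all_boot all_order all_algebra.
From mathcomp Require Import all_classical all_reals all_analysis.
From mathcomp Require Import complex.

Set Implicit Arguments.
Unset Strict Implicit.
Unset Printing Implicit Defensive.

Import Order.TTheory GRing.Theory Num.Theory.
Import numFieldNormedType.Exports.

Local Open Scope classical_set_scope.
Local Open Scope ring_scope.
Local Open Scope complex_scope.

Section Hyperbolic.
Context {R : realType}.

Definition cosh (x : R) : R := (expR x + expR (- x)) / 2.
Definition sinh (x : R) : R := (expR x - expR (- x)) / 2.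
Definition coth (x : R) : R := cosh x / sinh x.

End Hyperbolic.

Section ComplexFunctions.
Context {R : realType}.
Implicit Types (f g : R -> R[i]) (A : set R).

Definition cmod (z : R[i]) : R := Normc.normc z.

(* The limit and derivative of a complex-valued function of a real variable are
   taken componentwise; at a point where a component is not differentiable
   [derive1] takes a junk value. *)
Definition clim (F : set_system R) f : R[i] :=
  lim ((fun t => complex.Re (f t)) @ F) +i* lim ((fun t => complex.Im (f t)) @ F).

Definition cderive f (x : R) : R[i] :=
  derive1 (fun t => complex.Re (f t)) x +i* derive1 (fun t => complex.Im (f t)) x.

Definition absolutely_continuous_on A f : Prop :=
  forall e : R, 0 < e -> exists2 d : R, 0 < d &
    forall (m : nat) (a b : 'I_m -> R),
      (forall k, a k <= b k /\ `[a k, b k] `<=` A) ->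
      trivIset [set: 'I_m] (fun k => `]a k, b k[%classic) ->
      \sum_(k < m) (b k - a k) < d ->
      \sum_(k < m) cmod (f (b k) - f (a k)) < e.

Definition square_integrable A f : Prop :=
  [/\ measurable_fun A (fun t => complex.Re (f t)),
      measurable_fun A (fun t => complex.Im (f t)) &
      (@lebesgue_measure R).-integrable A (fun t => (cmod (f t) ^+ 2)%:E)].

Definition cintegral A f : R[i] :=
  (\int[@lebesgue_measure R]_(t in A) complex.Re (f t)) +i*
  (\int[@lebesgue_measure R]_(t in A) complex.Im (f t)).

Definition L2_inner A f g : R[i] := cintegral A (fun t => f t * (g t)^*).

End ComplexFunctions.

Section RKHS.
Context {R : realType} {X : Type}.
Implicit Types (H : set (X -> R[i])) (ip : (X -> R[i]) -> (X -> R[i]) -> R[i]).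

Definition is_subspace H : Prop :=
  H (fun=> 0) /\
  forall (c : R[i]) f g, H f -> H g -> H (fun x => c * f x + g x).

Definition is_inner_product H ip : Prop :=
  [/\ forall (c : R[i]) f g h, H f -> H g -> H h ->
        ip (fun x => c * f x + g x) h = c * ip f h + ip g h,
      forall f g, H f -> H g -> ip g f = (ip f g)^*,
      (* in [R[i]], [0 <= z] says that [z] is a nonnegative real *)
      forall f, H f -> 0 <= ip f f &
      forall f, H f -> ip f f = 0 -> f = (fun=> 0)].

Definition ip_norm ip (f : X -> R[i]) : R := Num.sqrt (complex.Re (ip f f)).

Definition is_complete H ip : Prop :=
  forall u : nat -> X -> R[i],
    (forall m, H (u m)) ->
    (forall e : R, 0 < e -> exists N : nat, forall p q : nat,
       (N <= p)%N -> (N <= q)%N -> ip_norm ip (fun x => u p x - u q x) < e) ->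
    exists2 l, H l &
      forall e : R, 0 < e -> exists N : nat, forall p : nat,
        (N <= p)%N -> ip_norm ip (fun x => u p x - l x) < e.

(* A Hilbert space of functions on [X] whose point evaluations are bounded
   linear functionals. *)
Definition is_RKHS H ip : Prop :=
  [/\ is_subspace H, is_inner_product H ip, is_complete H ip &
      forall x : X, exists M : R, forall f, H f -> cmod (f x) <= M * ip_norm ip f].

End RKHS.

Section Intervals.
Context {R : realType} {n : nat}.
Variables alpha beta : 'I_n -> R.

Definition J (i : 'I_n) : set R := `]alpha i, beta i[%classic.

Definition Omega : set R := \bigcup_i J i.

Definition extend0 (f : Omega -> R[i]) : R -> R[i] := 'valL_ 0 f.

Definition Dmax : set (Omega -> R[i]) := [set f |
  (forall i, absolutely_continuous_on (J i) (extend0 f)) /\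
  square_integrable Omega (cderive (extend0 f))].

Definition Dop (f : Omega -> R[i]) (x : R) : R[i] :=
  ((2 * pi)%:C * 'i)^-1 * cderive (extend0 f) x.

Definition graph_inner (f g : Omega -> R[i]) : R[i] :=
  L2_inner Omega (extend0 f) (extend0 g) + L2_inner Omega (Dop f) (Dop g).

(* Extension of [f] to the closure of [Omega] by one-sided limits; the last
   branch is meant for the right endpoints [beta i]. *)
Definition closure_value (f : Omega -> R[i]) (x : R) : R[i] :=
  if x \in Omega then extend0 f x
  else if [exists i, x == alpha i] then clim x^'+ (extend0 f)
  else clim x^'- (extend0 f).

Definition is_kernel (x : R) (k : Omega -> R[i]) : Prop :=
  Dmax k /\ forall f, Dmax f -> graph_inner f k = closure_value f x.

(* The factor [2 * pi] in the three kernels is forced by the normalisation of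
   [Dop]: testing the reproducing property against the indicator of the
   interval gives total integral 1, while without this factor the integral is
   [(2 * pi)^-1]. *)
Definition kernel_left (i : 'I_n) (t : Omega) : R[i] :=
  (2 * pi * \1_(J i) (val t) *
   (cosh (2 * pi * (beta i - val t)) / sinh (2 * pi * (beta i - alpha i))))%:C.

Definition kernel_right (i : 'I_n) (t : Omega) : R[i] :=
  (2 * pi * \1_(J i) (val t) *
   (cosh (2 * pi * (val t - alpha i)) / sinh (2 * pi * (beta i - alpha i))))%:C.

Definition kernel_system (j : 'I_n) (x : R) (AB : R * R) : Prop :=
  AB.1 + AB.2 = 1 /\
  AB.1 * coth (2 * pi * (x - alpha j)) -
  AB.2 * coth (2 * pi * (beta j - x)) = 0.

(* The second interval is open at [x]: by [kernel_system] the two branches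
   agree there, and their common value must be counted once. *)
Definition kernel_interior (j : 'I_n) (x : R) (AB : R * R) (t : Omega) : R[i] :=
  (2 * pi *
   (AB.1 * \1_(`]alpha j, x]%classic) (val t) *
      (cosh (2 * pi * (val t - alpha j)) / sinh (2 * pi * (x - alpha j))) +
    AB.2 * \1_(`]x, beta j[%classic) (val t) *
      (cosh (2 * pi * (beta j - val t)) / sinh (2 * pi * (beta j - x)))))%:C.

End Intervals.

(* Main.v *)
Require Import Defs.
From HB Require Import structures.
From mathcomp Require Import all_boot all_order all_algebra.
From mathcomp Require Import all_classical all_reals all_analysis.
From mathcomp Require Import measurable_realfun complex ring lra.

Import Order.TTheory GRing.Theory Num.Theory.
Import numFieldNormedType.Exports.

Local Open Scope classical_set_scope.
Local Open Scope ring_scope.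
Local Open Scope complex_scope.

Set Implicit Arguments.
Unset Strict Implicit.
Unset Printing Implicit Defensive.

(**
Taking real and imaginary parts reduces everything to the real bilinear form
[∫ u v + w^-2 ∫ u' v'] on absolutely continuous real functions, with [w = 2 pi].

An absolutely continuous function on a bounded interval extends continuously to
the closure, is a difference of two nondecreasing absolutely continuous functions
(total variation), and the Lebesgue-Stieltjes measures of these have densities by
Radon-Nikodym; so it is the primitive of its derivative. Integration by parts is
then available, and applied on both sides of [x] it shows that the function
[w cosh (w (min t x - alpha_j)) cosh (w (max t x - beta_j)) / sinh (w (beta_j - alpha_j))]
on [J_j], which solves [k'' = w^2 k] off [x], has vanishing derivative at the
endpoints and a jump of [- w^2] in its derivative at [x], represents the evaluation
at [x]. For [x] an endpoint or an interior point it is the announced kernel.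

By Cauchy-Schwarz the evaluations are bounded, so a Cauchy sequence converges
pointwise to some [l]; its derivatives converge in [L2] to some [g], and passing to
the limit in the fundamental theorem shows that [l] is a primitive of [g].
*)

(** * Absolutely continuous functions *)

(** Two features of the definitions shape the work. [derive1] is total and takes a default value
    where there is no derivative, so identities between derivatives hold only almost everywhere, and
    the measurability of [derive1] itself has to be proved, which is done for every continuous
    function. The intervals are open, so endpoint values exist only through a continuous extension;
    composing with the projection [clamp] turns it into a function on the whole line, constant
    outside the interval. The kernel makes the integrand an exact derivative: on each side of [x],
    [k'' = w^2 k] gives [u k + w^-2 u' k' = w^-2 (u k')']. Only boundary terms remain. Those at the
    endpoints of the interval vanish, and the two at [x] combine by the addition formula for [sinh],
    which is where the denominator [sinh (w (beta_j - alpha_j))] comes from. [Omega] has finite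
    measure, so L2 convergence of derivatives implies L1 convergence; this is what allows passing to
    the limit in the fundamental theorem. *)

Section AbsoluteContinuity.
Context {R : realType}.
Implicit Types (A : set R) (h u v : R -> R) (a b x y : R).

(** Families are indexed by an arbitrary finite type, so that the condition applies without
    renumbering to families indexed by dependent pairs, as happens when each interval of a family is
    subdivided. *)
Definition ac_on A h : Prop :=
  forall e : R, 0 < e -> exists2 d : R, 0 < d &
    forall (I : finType) (a b : I -> R),
      (forall k, a k <= b k /\ `[a k, b k] `<=` A) ->
      trivIset [set: I] (fun k => `]a k, b k[%classic) ->
      \sum_k (b k - a k) < d -> \sum_k `|h (b k) - h (a k)| < e.

Lemma cmodE (z : R[i]) : cmod z = Num.sqrt (complex.Re z ^+ 2 + complex.Im z ^+ 2).
Proof. by case: z. Qed.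

Lemma cmod_ge_Re (z : R[i]) : `|complex.Re z| <= cmod z.
Proof. by rewrite cmodE -sqrtr_sqr ler_wsqrtr// lerDl sqr_ge0. Qed.

Lemma cmod_ge_Im (z : R[i]) : `|complex.Im z| <= cmod z.
Proof. by rewrite cmodE -sqrtr_sqr ler_wsqrtr// lerDr sqr_ge0. Qed.

Lemma cmod_le_ReIm (z : R[i]) : cmod z <= `|complex.Re z| + `|complex.Im z|.
Proof.
rewrite cmodE -[leRHS]ger0_norm ?addr_ge0// -sqrtr_sqr ler_wsqrtr//.
rewrite sqrrD !real_normK ?num_real//.
by have := mulr_ge0 (normr_ge0 (complex.Re z)) (normr_ge0 (complex.Im z)); lra.
Qed.

Lemma absolutely_continuous_on_ac A (f : R -> R[i]) :
  absolutely_continuous_on A f <->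
  ac_on A (fun t => complex.Re (f t)) /\ ac_on A (fun t => complex.Im (f t)).
Proof.
split=> [acf|[acr aci] e e0].
- have main (h : R -> R) : (forall s t, `|h s - h t| <= cmod (f s - f t)) ->
      ac_on A h.
    move=> hle e /acf[d d0 fd]; exists d => // I a b abA tab sab.
    have sumE (F : I -> R) : \sum_k F k = \sum_(k < #|I|) F (enum_val k).
      by rewrite -(big_enum_val (A := I) F); exact: eq_bigl.
    rewrite sumE.
    apply: (le_lt_trans (y := \sum_(k < #|I|)
        cmod (f (b (enum_val k)) - f (a (enum_val k))))).
      by apply: ler_sum => k _.
    apply: (fd _ (a \o enum_val) (b \o enum_val)) => /=.
    + by move=> k; exact: abA.
    + move=> i j _ _ /(tab (enum_val i) (enum_val j) Logic.I Logic.I).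
      exact: enum_val_inj.
    + by rewrite -(sumE (fun k => b k - a k)).
  split; apply: main => s t.
  + apply: le_trans (cmod_ge_Re _); by case: (f s) (f t) => [? ?] [? ?].
  + apply: le_trans (cmod_ge_Im _); by case: (f s) (f t) => [? ?] [? ?].
- have e20 : 0 < e / 2 by rewrite divr_gt0.
  have [d1 d10 h1] := acr _ e20; have [d2 d20 h2] := aci _ e20.
  exists (Num.min d1 d2); first by rewrite lt_min d10.
  move=> m a b abA tab; rewrite lt_min => /andP[s1 s2].
  have {}h1 := h1 _ _ _ abA tab s1; have {}h2 := h2 _ _ _ abA tab s2.
  apply: (le_lt_trans _ (y := \sum_k `|complex.Re (f (b k)) - complex.Re (f (a k))|
     + \sum_k `|complex.Im (f (b k)) - complex.Im (f (a k))|)); last by lra.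
  rewrite -big_split/=; apply: ler_sum => k _.
  by apply: le_trans (cmod_le_ReIm _) _; case: (f (b k)) (f (a k)) => [? ?] [? ?].
Qed.

Lemma ac_on_dist A h : ac_on A h -> forall e, 0 < e -> exists2 d, 0 < d &
  forall x y, x <= y -> `[x, y] `<=` A -> y - x < d -> `|h y - h x| < e.
Proof.
move=> ach e /ach[d d0 hd]; exists d => // x y xy xyA yx.
have := hd unit (fun=> x) (fun=> y).
rewrite !big_const !card_unit /= !addr0; apply => //.
by move=> [] [].
Qed.

Lemma eq_ac_on A h k : {in A, h =1 k} -> ac_on A h -> ac_on A k.
Proof.
move=> hk ach e /ach[d d0 hd]; exists d => // I a b abA tab sab.
rewrite (eq_bigr (fun k => `|h (b k) - h (a k)|)); first exact: hd.
move=> i _; have [ab sabA] := abA i.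
by rewrite !hk// inE; apply: sabA; rewrite /= in_itv/= lexx ab.
Qed.

(** Common source of the closure properties below: linear combinations, products of bounded
    functions and Lipschitz functions all have increments dominated by those of two known
    functions. *)
Lemma ac_on_le A h u v C : ac_on A u -> ac_on A v ->
  (forall x y, x <= y -> `[x, y] `<=` A ->
     `|h y - h x| <= C * (`|u y - u x| + `|v y - v x|)) -> ac_on A h.
Proof.
move=> acu acv hle e e0.
(* The sign of [C] is not prescribed; [|C| + 1] is a positive bound that can be divided by. *)
have C0 : 0 < `|C| + 1 by rewrite ltr_wpDl.
have e20 : 0 < e / (2 * (`|C| + 1)) by rewrite divr_gt0// mulr_gt0.
have [d1 d10 h1] := acu _ e20; have [d2 d20 h2] := acv _ e20.
exists (Num.min d1 d2); first by rewrite lt_min d10.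
move=> I a b abA tab; rewrite lt_min => /andP[s1 s2].
have {}h1 := h1 _ _ _ abA tab s1; have {}h2 := h2 _ _ _ abA tab s2.
apply: (@le_lt_trans _ _ ((`|C| + 1) *
    (\sum_k `|u (b k) - u (a k)| + \sum_k `|v (b k) - v (a k)|))).
  rewrite -big_split/= mulr_sumr; apply: ler_sum => k _.
  have [ab sab] := abA k.
  apply: (le_trans (hle _ _ ab sab)); rewrite ler_wpM2r ?addr_ge0//.
  by rewrite (le_trans (ler_norm _))// lerDl.
have := ltrD h1 h2; rewrite -(ltr_pM2l C0); move/lt_le_trans; apply.
by rewrite le_eqVlt; apply/orP; left; apply/eqP; field; apply: lt0r_neq0.
Qed.

Lemma ac_on_lin A c u v : ac_on A u -> ac_on A v ->
  ac_on A (fun x => c * u x + v x).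
Proof.
move=> acu acv; apply: (ac_on_le (C := `|c| + 1) acu acv) => x y _ _.
rewrite (_ : _ - _ = c * (u y - u x) + (v y - v x)); last by ring.
rewrite (le_trans (ler_normD _ _))// normrM mulrDl mul1r.
have := mulr_ge0 (normr_ge0 c) (normr_ge0 (v y - v x)).
by have := normr_ge0 (u y - u x); lra.
Qed.

Lemma ac_on_mul A u v M : ac_on A u -> ac_on A v ->
  (forall x, A x -> `|u x| <= M) -> (forall x, A x -> `|v x| <= M) ->
  ac_on A (fun x => u x * v x).
Proof.
move=> acu acv uM vM; apply: (ac_on_le (C := M) acu acv) => x y xy xyA.
rewrite (_ : _ - _ = v y * (u y - u x) + u x * (v y - v x)); last by ring.
rewrite (le_trans (ler_normD _ _))// !normrM mulrDr.
have Ax : A x by apply: xyA; rewrite /= in_itv/= lexx.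
have Ay : A y by apply: xyA; rewrite /= in_itv/= lexx andbT.
by rewrite lerD// ler_wpM2r// ?vM// uM.
Qed.

Lemma ac_on_id A : ac_on A id.
Proof.
move=> e e0; exists e => // I a b abA _.
suff -> : \sum_k `|id (b k) - id (a k)| = \sum_k (b k - a k) by [].
by apply: eq_bigr => k _; rewrite ger0_norm// subr_ge0; have [] := abA k.
Qed.

Lemma ac_on_lipschitz A h C : (forall x y, x <= y -> `[x, y] `<=` A ->
     `|h y - h x| <= C * (y - x)) -> ac_on A h.
Proof.
move=> hC; apply: (ac_on_le (C := C / 2) (@ac_on_id A) (@ac_on_id A)).
move=> x y xy xyA; rewrite (le_trans (hC _ _ xy xyA))// ger0_norm ?subr_ge0//.
by lra.
Qed.

Lemma ac_on_cst A c : ac_on A (cst c).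
Proof.
by apply: (@ac_on_lipschitz _ _ 0) => x y _ _; rewrite mul0r subrr normr0.
Qed.

(** Since [d] does not depend on [n], the bound [e / 2] for each [h_ n] passes to the limit as a
    weak inequality, still below [e]. *)
Lemma ac_on_cvgn A (h_ : nat -> R -> R) h :
  (forall e, 0 < e -> exists2 d, 0 < d & forall n (I : finType) (a b : I -> R),
      (forall k, a k <= b k /\ `[a k, b k] `<=` A) ->
      trivIset [set: I] (fun k => `]a k, b k[%classic) ->
      \sum_k (b k - a k) < d -> \sum_k `|h_ n (b k) - h_ n (a k)| < e) ->
  (forall x, A x -> h_ n x @[n --> \oo] --> h x) -> ac_on A h.
Proof.
move=> ach hh e e0; have e20 : 0 < e / 2 by rewrite divr_gt0.
have [d d0 hd] := ach _ e20; exists d => // I a b abA tab sab.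
apply: (@le_lt_trans _ _ (e / 2)); last by lra.
have hcvg : \sum_k `|h_ n (b k) - h_ n (a k)| @[n --> \oo] -->
    \sum_k `|h (b k) - h (a k)|.
  apply: (@cvg_big _ _ _ _ _ _ _ \oo _ (fun k n => `|h_ n (b k) - h_ n (a k)|)) => [|k _].
    exact: add_continuous.
  have [ab sabA] := abA k.
  apply: cvg_norm; apply: cvgB; apply: hh; apply: sabA;
  by rewrite /= in_itv/= lexx ?andbT.
rewrite -(cvg_lim _ hcvg)//; apply: limr_le; first exact: cvgP hcvg.
by apply: nearW => n; apply/ltW/hd.
Qed.

Lemma ac_onT_continuous h : ac_on setT h -> continuous h.
Proof.
move=> /ac_on_dist ach x; apply/cvgrPdist_lt => e /ach[d d0 hd].
exists d => // y /= xyd; have [xy|/ltW yx] := leP x y.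
- by rewrite distrC; apply: hd => //; rewrite -(ger0_norm (x := y - x)) ?subr_ge0// distrC.
- by apply: hd => //; rewrite -(ger0_norm (x := x - y)) ?subr_ge0.
Qed.

(** For [a <= b] this is the nearest-point projection onto [[a, b]]. The condition
    [h (clamp a b x) = h x] used below says that [h] is constant on each side of [[a, b]]. *)
Definition clamp a b x := Num.min (Num.max x a) b.

Lemma clamp_in a b x : a <= b -> a <= clamp a b x <= b.
Proof. by move=> ab; rewrite /clamp le_min ge_min le_max !lexx !orbT ab. Qed.

Lemma clamp_id a b x : a <= x <= b -> clamp a b x = x.
Proof. by move=> /andP[ax xb]; rewrite /clamp (max_idPl ax) (min_idPl xb). Qed.

Lemma clamp_homo a b : {homo clamp a b : x y / x <= y}.
Proof.
move=> x y xy; rewrite /clamp le_min ge_min ge_min lexx orbT andbT.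
by rewrite ge_max !le_max xy lexx orbT.
Qed.

Lemma clampB_le a b x y : x <= y -> clamp a b y - clamp a b x <= y - x.
Proof. move=> xy; rewrite /clamp /Num.min /Num.max.
by case: (ltP x a) => ?; case: (ltP y a) => ?; do ! case: ltP => ?; lra.
Qed.

Lemma clamp_le a b x : a <= b -> x <= a -> clamp a b x = a.
Proof. by move=> ab xa; rewrite /clamp (max_idPr xa) (min_idPl ab). Qed.

Lemma clamp_ge a b x : a <= b -> b <= x -> clamp a b x = b.
Proof.
by move=> ab bx; rewrite /clamp (max_idPl (le_trans ab bx)) (min_idPr bx).
Qed.

Lemma clamp_clamp a b a' b' x : a <= a' -> a' <= b' -> b' <= b ->
  clamp a' b' (clamp a b x) = clamp a' b' x.
Proof.
move=> aa ab bb; have ab0 : a <= b by lra.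
have [xa|/ltW ax] := leP x a; first by rewrite (clamp_le _ xa)// !clamp_le//; lra.
have [bx|/ltW xb] := leP b x; first by rewrite (clamp_ge _ bx)// !clamp_ge//; lra.
by rewrite (@clamp_id a b)// ax.
Qed.

Lemma clamp_shrink a b w w' x : 0 <= w' -> w' <= w -> a + w <= b - w ->
  `|clamp (a + w) (b - w) x - clamp (a + w') (b - w') x| <= w.
Proof.
move=> w0 ww ab; rewrite -(@clamp_clamp (a + w') (b - w')); [|lra..].
have /andP[] : a + w' <= clamp (a + w') (b - w') x <= b - w' by apply: clamp_in; lra.
move: (clamp _ _ x) => y ay yb; rewrite ler_norml.
have [ya|ay'] := leP y (a + w); first by rewrite clamp_le//; lra.
have [yb'|yb'] := leP (b - w) y; first by rewrite clamp_ge//; lra.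
by rewrite clamp_id ?(ltW ay') ?(ltW yb')//; lra.
Qed.

(** Clamping both ends shrinks an open interval, so it keeps disjoint families disjoint. *)
Lemma clamp_itvoo a b x y :
  `]clamp a b x, clamp a b y[ `<=` `]x, y[.
Proof.
move=> t /=; rewrite !in_itv/= /clamp gt_min lt_min gt_max.
move=> /andP[/orP[/andP[xt at_]|bt] /andP[]].
  rewrite lt_max => /orP[ty _|/lt_trans/(_ at_)]; last by rewrite ltxx.
  by rewrite xt ty.
by move=> _ /lt_trans/(_ bt); rewrite ltxx.
Qed.

Lemma ac_on_clamp a b h : a <= b -> ac_on `[a, b] h ->
  ac_on setT (h \o clamp a b).
Proof.
move=> ab ach e /ach[d d0 hd]; exists d => // I l r lr tlr slr.
apply: (hd _ (clamp a b \o l) (clamp a b \o r)) => /=.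
- move=> k; split; first by apply: clamp_homo; exact: (lr k).1.
  have /andP[la _] := clamp_in (l k) ab; have /andP[_ rb] := clamp_in (r k) ab.
  by apply: subset_itvScc; rewrite bnd_simp.
- by move=> i j _ _ [t [ti tj]]; apply: (tlr i j) => //; exists t; split;
    apply: clamp_itvoo; eassumption.
- apply: le_lt_trans slr; apply: ler_sum => k _; apply: clampB_le.
  exact: (lr k).1.
Qed.

Lemma cvgn_cauchy (s : nat -> R) :
  (forall e, 0 < e -> exists N, forall p q, (N <= p)%N -> (N <= q)%N ->
     `|s p - s q| < e) -> cvgn s.
Proof.
move=> sc; apply/cauchy_cvgP/cauchy_exP => e /sc[N hN].
by exists (s N); exists N => // p /= Np; exact: hN.
Qed.

(* The values at the endpoints are obtained as limits of the restrictions to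
   an exhausting sequence of compact subintervals, which are absolutely
   continuous uniformly in the sequence. *)
Lemma ac_on_itvoo_extend a b h : a < b -> ac_on `]a, b[ h ->
  exists H, [/\ ac_on setT H, {in `]a, b[, H =1 h} & forall x, H (clamp a b x) = H x].
Proof.
(* The margin is at most a third of the length, so the compact intervals [[a + w n, b - w n]] are
   never empty; they increase to []a, b[]. *)
move=> ab ach; pose w n := (b - a) / (n.+3)%:R.
have w0 n : 0 < w n by rewrite divr_gt0// subr_gt0.
have wS n : w n <= (b - a) / 3.
  by rewrite ler_pM2l ?subr_gt0// lef_pV2 ?posrE// ler_nat.
have wdecr m n : (m <= n)%N -> w n <= w m.
  by move=> mn; rewrite ler_pM2l ?subr_gt0// lef_pV2 ?posrE// ler_nat.
have w_cvg0 e : 0 < e -> exists N, forall n, (N <= n)%N -> w n < e.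
  move=> e0; exists (Num.truncn ((b - a) / e)).+1 => n Nn.
  rewrite ltr_pdivrMr// mulrC -ltr_pdivrMr//.
  apply: (lt_le_trans (truncnS_gt _)); rewrite ler_nat.
  by rewrite (leq_trans Nn)// (leq_trans (leqnSn _))// (leq_trans (leqnSn _)).
pose c n := clamp (a + w n) (b - w n).
have ab_n n : a + w n <= b - w n by have := wS n; lra.
have sub_n n : `[a + w n, b - w n] `<=` `]a, b[.
  by apply: subset_itvSoo; rewrite bnd_simp; have := w0 n; lra.
have c_in n x : c n x \in `]a, b[.
  by have := @sub_n n (c n x); rewrite /= !in_itv/= => -> //; exact: clamp_in.
have c_dist p q x : (p <= q)%N -> `|c p x - c q x| <= w p.
  by move=> /wdecr wpq; apply: clamp_shrink => //; exact: ltW.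
have ch e : 0 < e -> exists N, forall p q x, (N <= p)%N -> (N <= q)%N ->
    `|h (c p x) - h (c q x)| < e.
  move=> /(ac_on_dist ach)[d d0 hd]; have [N wN] := w_cvg0 _ d0.
  have hd' x y : x \in `]a, b[ -> y \in `]a, b[ -> `|x - y| < d -> `|h x - h y| < e.
    have sub x' y' : x' \in `]a, b[ -> y' \in `]a, b[ -> `[x', y'] `<=` `]a, b[.
      rewrite !in_itv/= => /andP[ax _] /andP[_ yb].
      by apply: subset_itvSoo; rewrite bnd_simp.
    move=> xab yab; have [xy|/ltW yx] := leP x y.
      rewrite !(distrC x) !(distrC (h x)) ger0_norm ?subr_ge0//.
      by apply: hd => //; exact: sub.
    by rewrite ger0_norm ?subr_ge0//; apply: hd => //; exact: sub.
  exists N => p q x Np Nq; apply: hd' => //.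
  have [pq|/ltnW qp] := leqP p q; first exact: le_lt_trans (c_dist _ _ _ pq) (wN _ Np).
  by rewrite distrC; exact: le_lt_trans (c_dist _ _ _ qp) (wN _ Nq).
have h_cvg x : cvgn (fun n => h (c n x)).
  by apply: cvgn_cauchy => e /ch[N hN]; exists N => p q; exact: hN.
exists (fun x => limn (fun n => h (c n x))); split.
- apply: (@ac_on_cvgn _ (fun n => h \o c n)) => [e /ach[d d0 hd]|x _]; last exact: h_cvg.
  exists d => // n I l r lr tlr slr; apply: (hd _ (c n \o l) (c n \o r)) => /=.
  + move=> k; split; first by apply: clamp_homo; exact: (lr k).1.
    apply: subset_trans (@sub_n n).
    have /andP[la _] := clamp_in (l k) (ab_n n).
    have /andP[_ rb] := clamp_in (r k) (ab_n n).
    by apply: subset_itvScc; rewrite bnd_simp.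
  + by move=> i j _ _ [t [ti tj]]; apply: (tlr i j) => //; exists t; split;
      apply: clamp_itvoo; eassumption.
  + apply: le_lt_trans slr; apply: ler_sum => k _; apply: clampB_le.
    exact: (lr k).1.
- move=> x xab; apply/cvg_lim => //.
  apply: (@cvg_trans _ (h x @[n --> \oo])); last exact: cvg_cst.
  apply: near_eq_cvg; move: xab; rewrite in_itv/= => /andP[ax xb].
  have [|N wN] := w_cvg0 (Num.min (x - a) (b - x)).
    by rewrite lt_min !subr_gt0 ax.
  exists N => // n /= /wN; rewrite lt_min => /andP[? ?].
  by rewrite /c clamp_id//; lra.
- move=> x; congr (limn _); apply/funext => n; rewrite /c clamp_clamp//.
  + by have := w0 n; lra.
  + by have := w0 n; lra.
Qed.

End AbsoluteContinuity.

(** * Fundamental theorem of calculus for absolutely continuous functions *)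

Section Variation.
Context {R : realType}.
Implicit Types (h : R -> R) (a b x y : R).

(** Partitioning every interval of a disjoint family yields again a disjoint family, indexed by
    pairs (interval, cell), whose total length telescopes to the original one; the bound for
    increments then applies to the cells. *)
Lemma sum_variation_lt h e d (I : finType) (a b : I -> R) (s : I -> seq R) :
  (forall (K : finType) (l r : K -> R), (forall k, l k <= r k) ->
      trivIset [set: K] (fun k => `]l k, r k[%classic) ->
      \sum_k (r k - l k) < d -> \sum_k `|h (r k) - h (l k)| < e) ->
  trivIset [set: I] (fun k => `]a k, b k[%classic) ->
  \sum_k (b k - a k) < d -> (forall k, itv_partition (a k) (b k) (s k)) ->
  \sum_k variation (a k) (b k) h (s k) < e.
Proof.
move=> hd tab sab ps.
pose N k := nth (b k) (a k :: s k).
have N_homo k i j : (i <= j)%N -> (j <= size (s k))%N -> N k i <= N k j.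
  move=> ij js; have [pk _] := ps k.
  by apply: (@sorted_leq_nth _ <=%R le_trans lexx) => //=;
    rewrite ?inE//= ?ltnS//; [exact: sub_path (@ltW _ _) _ _ pk|exact: leq_trans js].
have Na k : N k 0%N = a k by [].
have Nb k : N k (size (s k)) = b k by exact: itv_partition_nth_size.
have -> : \sum_k variation (a k) (b k) h (s k) =
    \sum_(p : {k : I & 'I_(size (s k))})
      `|h (N (tag p) (tagged p).+1) - h (N (tag p) (tagged p))|.
  under eq_bigr do rewrite /variation big_mkord.
  by rewrite (sig_big_dep _ (fun=> predT) (fun k (i : 'I_(size (s k))) => `|h (N k i.+1) - h (N k i)|)).
apply: hd => [[k i]|[k i] [l j] _ _ [t [/= ti tj]]|] /=.
- exact: N_homo.
- have sub m (q : 'I_(size (s m))) : `]N m q, N m q.+1[ `<=` `]a m, b m[.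
    apply: subset_itvSoo; rewrite bnd_simp.
      by rewrite -Na N_homo// ltnW.
    by rewrite -Nb N_homo.
  have kl : k = l.
    by apply: (tab k l) => //; exists t; split; [exact: sub ti|exact: sub tj].
  subst l; congr (existT _ _); apply: val_inj => /=.
  move: ti tj; rewrite !in_itv/= => /andP[ti1 ti2] /andP[tj1 tj2].
  have [ij|ji|//] := ltngtP i j.
  + have := @N_homo k i.+1 j ij (ltnW (ltn_ord j)).
    by move/(lt_le_trans ti2)/lt_trans/(_ tj1); rewrite ltxx.
  + have := @N_homo k j.+1 i ji (ltnW (ltn_ord i)).
    by move/(lt_le_trans tj2)/lt_trans/(_ ti1); rewrite ltxx.
- have <- : \sum_k \sum_(i < size (s k)) (N k i.+1 - N k i) =
      \sum_(p : {k : I & 'I_(size (s k))}) (N (tag p) (tagged p).+1 - N (tag p) (tagged p)).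
    by rewrite (sig_big_dep _ (fun=> predT) (fun k (i : 'I_(size (s k))) => N k i.+1 - N k i)).
  rewrite (eq_bigr (fun k => b k - a k))// => k _.
  by rewrite -(big_mkord xpredT (fun i => N k i.+1 - N k i)) telescope_sumr// Nb Na.
Qed.

(** Each total variation is approximated from below by the variation along one partition, and these
    partitions are treated together by [sum_variation_lt]. *)
Lemma sum_total_variation_le h e : ac_on setT h -> 0 < e -> exists2 d, 0 < d &
  forall (I : finType) (a b : I -> R), (forall k, a k <= b k) ->
    trivIset [set: I] (fun k => `]a k, b k[%classic) ->
    \sum_k (b k - a k) < d ->
    (\sum_k total_variation (a k) (b k) h <= e%:E)%E.
Proof.
move=> ach e0; have e20 : 0 < e / 2 by rewrite divr_gt0.
have [d d0 hd] := ach _ e20; exists d => // I a b ab tab sab.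
have {}hd (K : finType) (l r : K -> R) : (forall k, l k <= r k) ->
    trivIset [set: K] (fun k => `]l k, r k[%classic) ->
    \sum_k (r k - l k) < d -> \sum_k `|h (r k) - h (l k)| < e / 2.
  by move=> lr; apply: hd.
have tvfin k : total_variation (a k) (b k) h \is a fin_num.
  apply/bounded_variationP => //; exists (e / 2) => _ [s ps <-].
  have := @sum_variation_lt h _ _ 'I_1 (fun=> a k) (fun=> b k) (fun=> s) hd.
  rewrite !big_ord1 => H; apply/ltW/H => //.
  - by move=> i j; rewrite !ord1.
  - apply: le_lt_trans sab; rewrite (bigD1 k)//= lerDl sumr_ge0// => i _.
    by rewrite subr_ge0.
(* The error allowed per interval: [#|I|] of them add up to at most [e / 2]. The successor covers an
   empty [I]. *)
pose eta := e / 2 / (#|I|.+1)%:R.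
have eta0 : 0 < eta by rewrite divr_gt0.
have /choice[s sP] : forall k, exists s, itv_partition (a k) (b k) s /\
    fine (total_variation (a k) (b k) h) - eta < variation (a k) (b k) h s.
  move=> k; have := @ub_ereal_sup_adherent _ _ _ eta0 (tvfin k).
  case=> _ [_ [s ps <-] <-]; rewrite -/(total_variation _ _ _) => H.
  by exists s; split => //; rewrite -lte_fin EFinB fineK.
have := @sum_variation_lt h _ _ _ a b s hd tab sab (fun k => (sP k).1).
have -> : (\sum_k total_variation (a k) (b k) h =
    \sum_k (fine (total_variation (a k) (b k) h))%:E)%E.
  by apply: eq_bigr => k _; rewrite fineK.
rewrite sumEFin lee_fin => H.
apply: (@le_trans _ _ (\sum_k (variation (a k) (b k) h (s k) + eta))).
  by apply: ler_sum => k _; have := (sP k).2; lra.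
rewrite big_split/= sumr_const.
have : eta *+ #|I| <= e / 2.
  rewrite -mulr_natr /eta -mulrA ger_pMr// mulrC ler_pdivrMr// mul1r ler_nat.
  exact: leqnSn.
by lra.
Qed.

(** Cut [[a, b]] into [N + 1] pieces shorter than the [d] attached to [e = 1]: the variation on each
    piece is at most 1. *)
Lemma ac_bounded_variation h a b : ac_on setT h -> a <= b ->
  bounded_variation a b h.
Proof.
move=> ach ab; have [d d0 hd] := sum_total_variation_le ach ltr01.
have small x y : x <= y -> y - x < d -> (total_variation x y h <= 1)%E.
  move=> xy yx; have := hd 'I_1 (fun=> x) (fun=> y).
  rewrite !big_ord1; apply => //.
  by move=> i j; rewrite !ord1.
have [N Nd] : exists N : nat, (b - a) / N.+1%:R < d.
  exists (Num.truncn ((b - a) / d)).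
  by rewrite ltr_pdivrMr// mulrC -ltr_pdivrMr//; exact: truncnS_gt.
pose w := (b - a) / N.+1%:R.
have w0 : 0 <= w by rewrite divr_ge0// subr_ge0.
have tvn n : (total_variation a (a + n%:R * w) h <= n%:R%:E)%E.
  elim: n => [|n ih]; first by rewrite mul0r addr0 total_variationxx.
  have le1 : a <= a + n%:R * w by rewrite lerDl mulr_ge0.
  have le2 : a + n%:R * w <= a + n.+1%:R * w.
    by rewrite lerD2l ler_wpM2r// ler_nat.
  rewrite (total_variationD h le1 le2) -natr1 EFinD leeD//.
  apply: small; first by rewrite lerD2l ler_wpM2r// lerDl.
  by rewrite (_ : _ - _ = w)//; ring.
apply/bounded_variationP => //.
have := tvn N.+1; rewrite /w (_ : a + _ = b); last first.
  by rewrite mulrC divfK ?pnatr_eq0// addrC subrK.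
move=> H; rewrite ge0_fin_numE; last exact: total_variation_ge0.
exact: le_lt_trans H (ltry _).
Qed.

(** Variation is additive over adjacent intervals, so the increments of this function are total
    variations over the intervals of the family, which [sum_total_variation_le] controls. *)
Lemma ac_on_total_variation h a b : ac_on setT h -> a <= b ->
  ac_on setT (fun x => fine (total_variation a (clamp a b x) h)).
Proof.
move=> ach ab; apply: (@ac_on_clamp _ a b (fun x => fine (total_variation a x h)) ab).
move=> e e0; have e20 : 0 < e / 2 by rewrite divr_gt0.
have [d d0 hd] := sum_total_variation_le ach e20; exists d => // I l r lr tlr slr.
have {}hd := hd _ _ _ (fun k => (lr k).1) tlr slr.
have fin x y : x <= y -> total_variation x y h \is a fin_num.
  by move=> xy; apply/bounded_variationP => //; exact: ac_bounded_variation.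
have al k : a <= l k.
  have [lk] := lr k; move/(_ (l k)); rewrite /= !in_itv/= lexx lk => /(_ isT).
  by case/andP.
apply: (@le_lt_trans _ _ (e / 2)); last by lra.
rewrite -lee_fin; apply: le_trans hd; rewrite -sumEFin; apply: lee_sum => k _.
have lk := (lr k).1.
rewrite (total_variationD h (al k) lk) fineD ?fin// addrAC subrr add0r ger0_norm.
  by rewrite fineK// fin.
by rewrite fine_ge0// total_variation_ge0.
Qed.

Lemma ac_on_jordan h a b : a <= b -> ac_on setT h ->
  (forall x, h (clamp a b x) = h x) -> exists p q, [/\ h = p \- q,
    {homo p : x y / x <= y} /\ {homo q : x y / x <= y},
    ac_on setT p /\ ac_on setT q,
    forall x, p (clamp a b x) = p x & forall x, q (clamp a b x) = q x].
Proof.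
move=> ab ach hc; have cc x : clamp a b (clamp a b x) = clamp a b x.
  by rewrite clamp_clamp.
pose p x := fine (total_variation a (clamp a b x) h).
have pc x : p (clamp a b x) = p x by rewrite /p cc.
have acp : ac_on setT p by exact: ac_on_total_variation.
have fin x y : x <= y -> total_variation x y h \is a fin_num.
  by move=> xy; apply/bounded_variationP => //; exact: ac_bounded_variation.
have incr x y : x <= y -> `|h y - h x| <= p y - p x.
  move=> xy; rewrite -(hc x) -(hc y) /p.
  have ax : a <= clamp a b x by have /andP[] := clamp_in x ab.
  have cxy : clamp a b x <= clamp a b y by exact: clamp_homo.
  rewrite (total_variationD h ax cxy) fineD ?fin// addrAC subrr add0r -lee_fin fineK ?fin//.
  exact: total_variation_ge.
(* The inequality [incr] makes both [p] and [p - h] nondecreasing. *)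
exists p, (p \- h); split => //.
- by apply/funext => x /=; ring.
- split=> x y /incr; first by move=> H; have := normr_ge0 (h y - h x); lra.
  by move=> H; have := ler_norm (h y - h x); rewrite /=; lra.
- split=> //; have := ac_on_lin (-1) ach acp; congr ac_on; apply/funext => x /=.
  by ring.
- by move=> x /=; rewrite pc hc.
Qed.

End Variation.

(** * Stieltjes measures of absolutely continuous functions are dominated by Lebesgue measure *)

Section LebesgueStieltjesAC.
Context {R : realType}.
Notation mu := (@lebesgue_measure R).
Variable F : cumulative R R.
Hypothesis acF : ac_on setT F.
Let nu := lebesgue_stieltjes_measure F.

Lemma lebesgue_stieltjes_itv_oc (G : cumulative R R) (x y : R) : x <= y ->
  lebesgue_stieltjes_measure G `]x, y]%classic = (G y - G x)%:E.
Proof.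
move=> xy; rewrite /lebesgue_stieltjes_measure /measure_extension.
rewrite measurable_mu_extE/=; last exact: is_ocitv.
by rewrite wlength_itv_bnd.
Qed.

(** A set of the ring generated by the half-open intervals is a finite disjoint union of them, so
    this is the absolute continuity of [F] read on measures. *)
Lemma lebesgue_stieltjes_ring_le e : 0 < e -> exists2 d, 0 < d &
  forall A : set R, measurable (A : set (SetRing.type (ocitv_type R))) ->
    (mu A < d%:E)%E -> (nu A <= e%:E)%E.
Proof.
move=> e0; have [d d0 hd] := acF e0; exists d => // A mA Ad.
have [B [finB B0 trivB mB AB]] := SetRing.ring_finite_set mA.
have /choice[f fP] : forall X : set R, exists p : R * R,
    B X -> p.1 < p.2 /\ X = `]p.1, p.2]%classic.
  move=> X; have [BX|nBX] := pselect (B X); last by exists (0, 0).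
  have /ocitvP[X0|[p p12 ->]] := mB _ (mem_set BX).
    by have := B0 _ BX; rewrite X0 => /set0P; rewrite eqxx.
  by exists p.
have /finite_seqP[s0 Bs0] := finB.
(* Duplicates are removed so that distinct positions carry distinct, hence disjoint, intervals. *)
pose s := undup s0; have us : uniq s by exact: undup_uniq.
have Bs : B = [set` s] by rewrite Bs0; apply/seteqP; split => x /=; rewrite mem_undup.
pose X_ (k : 'I_(size s)) := tnth (in_tuple s) k.
have BX k : B (X_ k) by rewrite Bs /=; exact: mem_tnth.
(* Stated for every [G] because it is used twice: with [F] for [nu], and with the identity for
   Lebesgue measure. *)
have sumB (G : cumulative R R) : lebesgue_stieltjes_measure G A =
    (\sum_k (G (f (X_ k)).2 - G (f (X_ k)).1))%:E.
  rewrite AB (_ : \bigcup_(X in B) X = \big[setU/set0]_(k < size s) X_ k).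
    rewrite measure_bigsetU_ord//.
    - rewrite -sumEFin; apply: eq_bigr => k _; have [lt12 XE] := fP _ (BX k).
      rewrite -(lebesgue_stieltjes_itv_oc G (ltW lt12)).
      exact: (congr1 (lebesgue_stieltjes_measure G) XE).
    - by move=> k; have [_ ->] := fP _ (BX k); exact: measurable_itv.
    - move=> i j _ _ XX; have := trivB _ _ (BX i) (BX j) XX.
      by move/tuple_uniqP : (us : uniq (in_tuple s)); apply.
  rewrite Bs bigcup_seq /=.
  by rewrite [LHS](big_tnth _ _ s).
rewrite /nu sumB lee_fin.
rewrite (eq_bigr (fun k => `|F (f (X_ k)).2 - F (f (X_ k)).1|)); last first.
  move=> k _; rewrite ger0_norm// subr_ge0; apply: cumulative_is_nondecreasing.
  by have [/ltW] := fP _ (BX k).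
apply/ltW/(hd _ (fun k => (f (X_ k)).1) (fun k => (f (X_ k)).2)).
- by move=> k; split => //; have [/ltW] := fP _ (BX k).
- move=> i j _ _ [t [ti tj]]; have := trivB _ _ (BX i) (BX j).
  have XX : X_ i `&` X_ j !=set0.
    have [_ ->] := fP _ (BX i); have [_ ->] := fP _ (BX j).
    by exists t; split; apply: subset_itv_oo_oc.
  move=> /(_ XX); by move/tuple_uniqP : (us : uniq (in_tuple s)); apply.
- by have := sumB idfun; rewrite -lte_fin => <-.
Qed.

(** A null set has a countable cover by half-open intervals of total length below [d]. The finite
    partial unions lie in the ring, where the previous bound applies, and continuity from below
    carries it to the whole cover. *)
Lemma lebesgue_stieltjes_dominates : nu `<< mu.
Proof.
apply/null_content_dominatesP => D mD D0.
apply/eqP; rewrite eq_le measure_ge0 andbT; apply/lee_addgt0Pr => e e0.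
rewrite add0e; have [d d0 hd] := lebesgue_stieltjes_ring_le e0.
have /ereal_inf_lt[z [/= M covDM sMz zd]] : (mu D < d%:E)%E by rewrite D0 lte_fin.
have mM k : ocitv (M k) by have [/(_ k)] := covDM.
have mM' k : measurable (M k : set R).
  by have [p _ <-] := mM k; exact: measurable_itv.
pose U n := \big[setU/set0]_(k < n) M k.
have mU n : measurable (U n : set R) by apply: bigsetU_measurable.
apply: (@le_trans _ _ (nu (\bigcup_n U n))).
  apply: le_measure; rewrite ?inE//; first exact: bigcupT_measurable.
  have [_ /subset_trans] := covDM; apply => x [n _ Mnx].
  by exists n.+1 => //; rewrite /U big_ord_recr/=; right.
have Ucvg : (nu \o U) n @[n --> \oo] --> nu (\bigcup_n U n).
  apply: nondecreasing_cvg_mu => //; first exact: bigcupT_measurable.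
  by move=> m n mn; apply/subsetPset; exact: subset_bigsetU.
rewrite -(cvg_lim _ Ucvg)//; apply: lime_le; first exact: cvgP Ucvg.
apply: nearW => n; apply: hd.
  by apply: bigsetU_measurable => k _; apply: sub_gen_smallest; exact: mM.
apply: le_lt_trans zd; rewrite -sMz.
have -> : (\sum_(0 <= k <oo) wlength idfun (M k) = \sum_(0 <= k <oo) mu (M k))%E.
  apply: eq_eseriesr => k _; rewrite /mu /lebesgue_stieltjes_measure /measure_extension.
  by rewrite measurable_mu_extE//; exact: mM.
apply: measure_sigma_subadditive => //; first exact: mU.
by rewrite /U -bigcup_mkord; apply: bigcup_sub => k _ x Mkx; exists k.
Qed.

End LebesgueStieltjesAC.

Section FundamentalTheorem.
Context {R : realType}.
Notation mu := (@lebesgue_measure R).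
Implicit Types (a b x y : R) (F h : R -> R).

(** As [F] is constant outside [[a, b]], its Stieltjes measure has mass at most [F b - F a]; being
    finite and dominated, it has a Radon-Nikodym density. *)
Lemma ac_nondecreasing_density a b F : a <= b -> ac_on setT F ->
  {homo F : x y / x <= y} -> (forall x, F (clamp a b x) = F x) ->
  exists2 g : R -> R, mu.-integrable setT (EFin \o g) &
    forall x y, x <= y -> F y - F x = \int[mu]_(t in `]x, y]) g t.
Proof.
move=> ab acF ndF Fc.
have rcF : forall x, F t @[t --> x^'+] --> F x.
  by move=> x; apply: cvg_at_right_filter; exact: ac_onT_continuous.
pose G : cumulative R R := HB.pack F (isCumulative.Build R _ R F ndF rcF).
pose nu0 := lebesgue_stieltjes_measure G.
have nuT : (nu0 setT <= (F b - F a)%:E)%E.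
  pose U n : set R := `](- n%:R), n%:R]%classic.
  have UT : \bigcup_n U n = setT by exact: bigcup_itvT.
  have Ucvg : (nu0 \o U) n @[n --> \oo] --> nu0 (\bigcup_n U n).
    apply: nondecreasing_cvg_mu.
    - by move=> n; exact: measurable_itv.
    - by apply: bigcupT_measurable => n; exact: measurable_itv.
    - move=> m n mn; apply/subsetPset; apply: subset_itv; rewrite bnd_simp.
        by rewrite lerN2 ler_nat.
      by rewrite ler_nat.
  rewrite -UT -(cvg_lim _ Ucvg)//; apply: lime_le; first exact: cvgP Ucvg.
  apply: nearW => n; rewrite /= /nu0 lebesgue_stieltjes_itv_oc ?ge0_cp// lee_fin /=.
  have c1 := Fc n%:R; have c2 := Fc (- n%:R); rewrite -c1 -c2.
  by apply: lerB; apply: (ndF); [have /andP[] := clamp_in n%:R ab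
                              |have /andP[] := clamp_in (- n%:R) ab].
have nufin : fin_num_fun nu0.
  move=> U mU; rewrite ge0_fin_numE//; apply: le_lt_trans (ltry (F b - F a)).
  by apply: le_trans nuT; apply: le_measure; rewrite ?inE.
pose nu : {finite_measure set (measurableTypeR R) -> \bar R} :=
  HB.pack nu0 (Measure_isFinite.Build _ _ _ nu0 nufin).
have [f [f0 ffin fint fE]] := @radon_nikodym_sigma_finite _ _ R mu nu
  (@lebesgue_stieltjes_dominates R G acF).
exists (fine \o f).
  by rewrite (_ : EFin \o _ = f)//; apply/funext => x /=; rewrite fineK.
move=> x y xy; apply: EFin_inj.
rewrite -(lebesgue_stieltjes_itv_oc G xy) /Rintegral.
under eq_integral do rewrite /= fineK//.
rewrite -fE; last exact: measurable_itv.
by rewrite fineK//; exact: (nufin).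
Qed.

(** The density is the difference of those of the two monotone parts. Lebesgue differentiation
    applies to the primitive [H] of [g] from minus infinity, which differs from [h] by a
    constant. *)
Lemma ac_FTC a b h : a <= b -> ac_on setT h -> (forall x, h (clamp a b x) = h x) ->
  exists g : R -> R, [/\ mu.-integrable setT (EFin \o g),
    forall x y, x <= y -> h y - h x = \int[mu]_(t in `]x, y]) g t &
    {ae mu, forall x, derivable h x 1 /\ derive1 h x = g x}].
Proof.
move=> ab ach hc; have [p [q [hpq [ndp ndq] [acp acq] pc qc]]] := ac_on_jordan ab ach hc.
have [gp igp pE] := ac_nondecreasing_density ab acp ndp pc.
have [gq igq qE] := ac_nondecreasing_density ab acq ndq qc.
pose g := gp \- gq.
have ig : mu.-integrable setT (EFin \o g).
  exact: (integrableB measurableT igp igq).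
have igS (A : set R) : measurable A -> mu.-integrable A (EFin \o g).
  by move=> mA; apply: integrableS ig.
have hE x y : x <= y -> h y - h x = \int[mu]_(t in `]x, y]) g t.
  move=> xy; rewrite RintegralB//; last 2 first.
    by apply: integrableS igp.
    by apply: integrableS igq.
  by rewrite -pE// -qE// hpq /=; ring.
exists g; split => //.
pose H x := \int[mu]_(t in `]-oo, x]) g t.
have HE x y : x <= y -> H y - H x = h y - h x.
  by move=> xy; rewrite hE// Rintegral_itvB//; exact: igS.
have {}HE x : h x = H x + (h 0 - H 0).
  by have [/HE|/ltW/HE] := leP x 0; lra.
have : {ae mu, forall x, derivable H x 1 /\ derive1 H x = g x}.
  apply: FTC1Ny; first by move=> y; exact: igS.
  exact: open_integrable_locally openT ig.
apply: filterS; first exact: (ae_filter_ringOfSetsType mu).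
move=> x [dH H'].
have -> : h = H \+ cst (h 0 - H 0) by apply/funext => y; rewrite HE.
split; first by apply: derivableD => //; exact: derivable_cst.
by rewrite derive1E deriveD// derive_cst addr0 -derive1E.
Qed.

End FundamentalTheorem.

(** * Measurability of the derivative of a continuous function *)

Section DeriveMeasurable.
Context {R : realType}.
Implicit Types (f : R -> R).

Let q f (x h : R) := h^-1 * (f (h + x) - f x).

(** The weak inequality makes this set closed for continuous [f]; the set of points of derivability
    is then a countable intersection of countable unions of closed sets. *)
Let osc f (k j : nat) : set R := [set x | forall h h', 0 < `|h| < j.+1%:R^-1 ->
  0 < `|h'| < j.+1%:R^-1 -> `|q f x h - q f x h'| <= k.+1%:R^-1].

Let continuous_q f h : continuous f -> continuous (q f ^~ h).
Proof.
move=> cf x; apply: cvgM; first exact: cvg_cst.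
apply: cvgB; last exact: cf.
by apply: (continuous_comp (f := fun x => h + x)); [exact: cvgD (cvg_cst _) cvg_id|exact: cf].
Qed.

Let closed_osc f k j : continuous f -> closed (osc f k j).
Proof.
move=> cf; have -> : osc f k j = \bigcap_(p in
    [set p : R * R | 0 < `|p.1| < j.+1%:R^-1 /\ 0 < `|p.2| < j.+1%:R^-1])
    ((fun x => `|q f x p.1 - q f x p.2|) @^-1` [set y | y <= k.+1%:R^-1]).
  apply/seteqP; split => [x ox [h h'] [/= h0 h0']|x ox h h' h0 h0']; first exact: ox.
  exact: (ox (h, h')).
apply: closed_bigI => -[h h'] _; apply: preimage_closed; last exact: closed_le.
by move=> x _; apply: cvg_norm; apply: cvgB; exact: continuous_q.
Qed.

(** This is the Cauchy criterion for the difference quotients at 0. *)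
Let cvg_osc f : [set x | cvg (q f x h @[h --> 0^'])] = \bigcap_k \bigcup_j osc f k j.
Proof.
apply/seteqP; split => [x /cvg_ex[l /cvgrPdist_lt ql] k _|x xosc].
  have [|r r0 qr] := ql (k.+1%:R^-1 / 2); first by rewrite divr_gt0.
  have [j jr] : exists j : nat, j.+1%:R^-1 < r.
    by exists (Num.truncn r^-1); rewrite -[ltRHS]invrK ltf_pV2 ?posrE ?invr_gt0// truncnS_gt.
  exists j => // h h' /andP[h0 hj] /andP[h0' hj'].
  have close t : 0 < `|t| -> `|t| < j.+1%:R^-1 -> `|l - q f x t| < k.+1%:R^-1 / 2.
    move=> t0 tj; apply: qr; last by rewrite -normr_gt0.
    by rewrite /ball/= sub0r normrN (lt_trans tj).
  have := close _ h0 hj; have := close _ h0' hj'.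
  move=> c1 c2; apply: (le_trans (ler_distD l _ _)).
  by rewrite [leRHS]splitr (distrC (q f x h) l) ltW// ltrD.
apply/cauchy_cvgP/cauchy_exP => e e0.
have [k ke] : exists k : nat, k.+1%:R^-1 < e.
  by exists (Num.truncn e^-1); rewrite -[ltRHS]invrK ltf_pV2 ?posrE ?invr_gt0// truncnS_gt.
have [j _ xj] := xosc k I.
pose h0 : R := j.+1%:R^-1 / 2.
have h0j : 0 < `|h0| < j.+1%:R^-1.
  have : 0 < (j.+1%:R^-1 : R) by rewrite invr_gt0.
  move=> d0; rewrite gtr0_norm ?divr_gt0//= ltr_pdivrMr// ltr_pMr//.
  by rewrite ltr1n.
exists (q f x h0), j.+1%:R^-1 => /=; first by rewrite invr_gt0.
move=> h; rewrite /ball/= sub0r normrN => hj hn0; apply: le_lt_trans ke.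
by apply: xj => //; rewrite normr_gt0 hn0.
Qed.

Lemma continuous_measurable_derive1 f : continuous f ->
  measurable_fun setT (derive1 f).
Proof.
move=> cf; pose D := [set x | cvg (q f x h @[h --> 0^'])].
have mD : measurable D.
  rewrite /D cvg_osc; apply: bigcapT_measurable => k; apply: bigcupT_measurable => j.
  by apply: closed_measurable; exact: closed_osc.
(* Off [D] the default value of a divergent limit is one constant, so only [D] matters; there
   [derive1 f] is the limit of the quotients with increments [1 / (n + 1)]. *)
have -> : derive1 f = fun x => if x \in D then derive1 f x else point.
  apply/funext => x; case: ifPn => //; rewrite notin_setE => nD.
  exact: dvgP.
apply: measurable_fun_if => //.
- apply: (measurable_fun_bool true); rewrite setTI.
  by rewrite preimage_mem_true.
- apply: (@measurable_fun_cvg _ _ _ _ (fun n x => q f x n.+1%:R^-1)).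
    move=> n; apply: measurable_funTS; apply: continuous_measurable_fun.
    exact: continuous_q.
  move=> x [_ /set_mem Dx].
  have /cvgr_dnbhsP : q f x h @[h --> 0^'] --> derive1 f x by [].
  apply; split; first by move=> n; rewrite invr_neq0.
  exact: cvg_harmonic.
Qed.

End DeriveMeasurable.

(** * Square-integrable functions *)

Section Integrals.
Context {R : realType}.
Notation mu := (@lebesgue_measure R).
Implicit Types (D : set R) (f g h : R -> R) (a b x y : R).

Lemma ae_and (P Q : R -> Prop) : {ae mu, forall x, P x} -> {ae mu, forall x, Q x} ->
  {ae mu, forall x, P x /\ Q x}.
Proof. exact: (@filterI _ _ (ae_filter_ringOfSetsType mu)). Qed.

Lemma ae_impl (P Q : R -> Prop) : (forall x, P x -> Q x) ->
  {ae mu, forall x, P x} -> {ae mu, forall x, Q x}.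
Proof. exact: (@filterS _ _ (ae_filter_ringOfSetsType mu)). Qed.

Lemma integrableR_measurable D f : mu.-integrable D (EFin \o f) -> measurable_fun D f.
Proof. by move=> /integrableP[/measurable_EFinP]. Qed.

Lemma ae_eq_Rintegral D f g : measurable D -> measurable_fun D f ->
  measurable_fun D g -> {ae mu, forall x, D x -> f x = g x} ->
  \int[mu]_(x in D) f x = \int[mu]_(x in D) g x.
Proof.
move=> mD mf mg fg; congr fine; apply: ae_eq_integral => //.
- exact/measurable_EFinP.
- exact/measurable_EFinP.
- by apply: ae_impl fg => x fg Dx; rewrite fg.
Qed.

Lemma ae_eq_integrable D f g : measurable D -> measurable_fun D g ->
  {ae mu, forall x, D x -> f x = g x} ->
  mu.-integrable D (EFin \o f) -> mu.-integrable D (EFin \o g).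
Proof.
move=> mD mg fg /integrableP[mf fi]; apply/integrableP; split; first exact/measurable_EFinP.
rewrite -(@ae_eq_integral _ _ _ mu D _ (abse \o (EFin \o f)))//.
- exact: measurableT_comp.
- by apply: measurableT_comp => //; exact/measurable_EFinP.
- by apply: ae_impl fg => x fg Dx /=; rewrite fg.
Qed.

Lemma integrable_lin D f g c : measurable D -> mu.-integrable D (EFin \o f) ->
  mu.-integrable D (EFin \o g) -> mu.-integrable D (EFin \o (fun x => c * f x + g x)).
Proof.
move=> mD fi gi.
suff : mu.-integrable D (fun x => c%:E * (EFin \o f) x + (EFin \o g) x)%E.
  by apply: eq_integrable => // x _ /=; rewrite EFinD EFinM.
by apply: integrableD => //; exact: integrableZl.
Qed.

Lemma Rintegral_lin D f g c : measurable D -> mu.-integrable D (EFin \o f) ->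
  mu.-integrable D (EFin \o g) ->
  \int[mu]_(x in D) (c * f x + g x) = c * \int[mu]_(x in D) f x + \int[mu]_(x in D) g x.
Proof.
move=> mD fi gi; rewrite RintegralD//; first by rewrite RintegralZl.
suff : mu.-integrable D (fun x => c%:E * (EFin \o f) x)%E.
  by apply: eq_integrable => // x _ /=; rewrite EFinM.
exact: integrableZl.
Qed.

Definition L2 D f := measurable_fun D f /\ mu.-integrable D (EFin \o (fun t => f t ^+ 2)).

Lemma le_integrableR D f g : measurable D -> measurable_fun D f ->
  (forall x, D x -> `|f x| <= g x) -> mu.-integrable D (EFin \o g) ->
  mu.-integrable D (EFin \o f).
Proof.
move=> mD mf fg; apply: le_integrable => //; first exact/measurable_EFinP.
by move=> x Dx /=; rewrite lee_fin (le_trans (fg _ Dx))// ler_norm.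
Qed.

(** The product is dominated by [f^2 + g^2], since [(|f| - |g|)^2 >= 0]. *)
Lemma L2_mul D f g : measurable D -> L2 D f -> L2 D g ->
  mu.-integrable D (EFin \o (fun t => f t * g t)).
Proof.
move=> mD [mf fi] [mg gi]; apply: (le_integrableR (g := fun t => 1 * f t ^+ 2 + g t ^+ 2)) => //.
- exact: measurable_funM.
- move=> x Dx; rewrite mul1r normrM -(real_normK (num_real (f x))) -(real_normK (num_real (g x))).
  have := sqr_ge0 (`|f x| - `|g x|); rewrite sqrrB.
  by have := mulr_ge0 (normr_ge0 (f x)) (normr_ge0 (g x)); lra.
- exact: integrable_lin.
Qed.

Lemma L2_lin D f g c : measurable D -> L2 D f -> L2 D g -> L2 D (fun t => c * f t + g t).
Proof.
move=> mD Lf Lg; have [mf fi] := Lf; have [mg gi] := Lg; split.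
  by apply: measurable_funD => //; exact: measurable_funM.
have := integrable_lin (2 * c) mD (L2_mul mD Lf Lg) (integrable_lin (c ^+ 2) mD fi gi).
by apply: eq_integrable => // x _ /=; congr EFin; ring.
Qed.

Lemma ae_eq_L2 D f g : measurable D -> measurable_fun D g ->
  {ae mu, forall x, D x -> f x = g x} -> L2 D f -> L2 D g.
Proof.
move=> mD mg fg [mf fi]; split => //.
apply: (ae_eq_integrable (f := fun t => f t ^+ 2)) => //; first exact: measurable_funX.
by apply: ae_impl fg => x fg /fg ->.
Qed.

Lemma bounded_integrable D f M : measurable D -> (mu D < +oo)%E ->
  measurable_fun D f -> (forall x, D x -> `|f x| <= M) -> mu.-integrable D (EFin \o f).
Proof.
move=> mD Dfin mf fM; apply: measurable_bounded_integrable => //.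
exists M; split; first exact: num_real.
by move=> x Mx y Dy; rewrite /= (le_trans (fM _ Dy))// ltW.
Qed.

Lemma bounded_L2 D f M : measurable D -> (mu D < +oo)%E ->
  measurable_fun D f -> (forall x, D x -> `|f x| <= M) -> L2 D f.
Proof.
move=> mD Dfin mf fM; split => //; apply: (bounded_integrable (M := M ^+ 2)) => //.
  exact: measurable_funX.
by move=> x Dx; rewrite normrX lerXn2r ?nnegrE ?fM// (le_trans _ (fM _ Dx)).
Qed.

Lemma continuous_within_bounded_itv a b f : a <= b -> {within `[a, b], continuous f} ->
  exists M, forall x, a <= x <= b -> `|f x| <= M.
Proof.
move=> ab cf; have [|c _ cM] := @EVT_max R (fun x => `|f x|) a b ab.
  by move=> x; apply: cvg_norm; exact: cf.
by exists `|f c| => x xab; apply: cM.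
Qed.

Lemma derive1_lipschitz a b f f' : a <= b -> (forall x, is_derive x 1 f (f' x)) ->
  continuous f' -> exists C, forall x y, a <= x -> x <= y -> y <= b ->
    `|f y - f x| <= C * (y - x).
Proof.
move=> ab df cf'; have [|C CM] := continuous_within_bounded_itv (f := f') ab.
  exact: continuous_subspaceT.
exists C => x y ax xy yb.
have [|c cxy ->] := @MVT_segment R f f' x y xy (fun t _ => df t).
  apply: continuous_subspaceT => t; apply: differentiable_continuous.
  by apply/derivable1_diffP; have [] := df t.
rewrite normrM (ger0_norm (x := y - x)) ?subr_ge0// ler_wpM2r ?subr_ge0// CM//.
by move: cxy; rewrite in_itv/= => /andP[xc cy]; rewrite (le_trans ax xc) (le_trans cy yb).
Qed.

Lemma near_eq_derivable1 f g x : (\near x, f x = g x) ->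
  (derivable f x 1 <-> derivable g x 1) /\ derive1 f x = derive1 g x.
Proof.
move=> fg; split; last by rewrite !derive1E; exact: near_eq_derive.
split; apply: near_eq_derivable => //.
by apply: filterS fg => t ->.
Qed.

Lemma near_itvoo a b x : a < x < b -> \forall t \near x, a < t < b.
Proof. by move=> axb; have := @near_in_itvoo R a b x; rewrite in_itv/= => /(_ axb). Qed.

(** The form in which the fundamental theorem is used: [F] supplies the endpoint values that [f]
    lacks, while the integrand is [derive1 f] itself, default values included, because it agrees
    almost everywhere with the density. *)
Lemma ac_on_itvoo_FTC a b f : a < b -> ac_on `]a, b[ f -> exists F : R -> R,
  [/\ ac_on setT F, forall x, a < x < b -> F x = f x,
      measurable_fun `]a, b[ (derive1 f) /\ mu.-integrable `]a, b[ (EFin \o derive1 f),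
      forall x y, a <= x -> x <= y -> y <= b ->
        F y - F x = \int[mu]_(t in `]x, y[) derive1 f t &
      {ae mu, forall x, a < x < b -> derivable f x 1}].
Proof.
move=> ab acf; have [F [acF Ff Fc]] := ac_on_itvoo_extend ab acf.
have [g [gi FE aeF]] := ac_FTC (ltW ab) acF Fc.
have Fnear x : a < x < b -> \near x, F x = f x.
  by move=> /near_itvoo; apply: filterS => t atb; apply: Ff; rewrite in_itv.
have dE x : a < x < b -> derive1 f x = derive1 F x.
  by move=> /Fnear/near_eq_derivable1[].
have mdF : measurable_fun setT (derive1 F).
  by apply: continuous_measurable_derive1; exact: ac_onT_continuous.
have eqD (D : set R) : D `<=` `]a, b[ -> {in D, derive1 F =1 derive1 f}.
  by move=> Dab x /set_mem/Dab /=; rewrite in_itv/= => /dE ->.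
have mdf : measurable_fun `]a, b[ (derive1 f).
  apply: (eq_measurable_fun (derive1 F)); first exact: eqD.
  exact: measurable_funTS.
have gdf (D : set R) : D `<=` `]a, b[ -> {ae mu, forall x, D x -> g x = derive1 f x}.
  move=> Dab; apply: ae_impl aeF => x [_ <-] Dx; apply: eqD Dab _ _.
  exact: mem_set.
exists F; split => //.
- split => //; apply: (ae_eq_integrable (f := g)) => //; first exact: gdf.
  exact: integrableS gi.
- move=> x y ax xy yb; have sub : `]x, y[ `<=` `]a, b[.
    by apply: subset_itv; rewrite bnd_simp.
  rewrite FE// -Rintegral_itv_bndo_bndc; last exact: integrableS gi.
  apply: ae_eq_Rintegral => //.
  + by apply: integrableR_measurable; exact: integrableS gi.
  + exact: measurable_funS mdf.
  + exact: gdf.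
- apply: ae_impl aeF => x [dF _] axb.
  by have [[h _] _] := near_eq_derivable1 (Fnear _ axb); exact: h.
Qed.

End Integrals.

(** * Hyperbolic functions *)

Section Hyperbolic.
Context {R : realType}.
Implicit Types (a b t w : R).

Lemma sinh_gt0 t : 0 < t -> 0 < sinh t.
Proof. by move=> t0; rewrite /sinh divr_gt0// subr_gt0 ltr_expR; lra. Qed.

Lemma sinh0 : sinh (0 : R) = 0.
Proof. by rewrite /sinh oppr0 subrr mul0r. Qed.

Lemma cosh0 : cosh (0 : R) = 1.
Proof. by rewrite /cosh oppr0 expR0; field. Qed.

Lemma sinhD a b : sinh (a + b) = sinh a * cosh b + cosh a * sinh b.
Proof. by rewrite /sinh /cosh opprD !expRD; field. Qed.

Lemma is_derive_affine w c t : is_derive t (1 : R) (fun t => w * (t - c)) w.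
Proof.
rewrite (_ : (fun t => _) = w \*: (id \- cst c)); last by apply/funext => x.
apply: is_derive_eq; rewrite /= subr0.
by rewrite /GRing.scale /= mulr1.
Qed.

Lemma is_derive_expR_affine w c t :
  is_derive t (1 : R) (fun t => expR (w * (t - c))) (w * expR (w * (t - c))).
Proof.
rewrite mulrC; apply: (@is_derive1_comp R expR (fun t => w * (t - c))).
exact: is_derive_affine.
Qed.

Lemma is_derive_sinh w c t :
  is_derive t (1 : R) (fun t => sinh (w * (t - c))) (w * cosh (w * (t - c))).
Proof.
rewrite (_ : (fun t => _) = 2^-1 \*: ((fun t => expR (w * (t - c))) \-
   (fun t => expR ((- w) * (t - c))))); last first.
  by apply/funext => x /=; rewrite /sinh mulNr mulrC.
have d1 := is_derive_expR_affine w c t; have d2 := is_derive_expR_affine (- w) c t.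
by apply: is_derive_eq; rewrite /GRing.scale /= /cosh !mulNr; field.
Qed.

Lemma is_derive_cosh w c t :
  is_derive t (1 : R) (fun t => cosh (w * (t - c))) (w * sinh (w * (t - c))).
Proof.
rewrite (_ : (fun t => _) = 2^-1 \*: ((fun t => expR (w * (t - c))) \+
   (fun t => expR ((- w) * (t - c))))); last first.
  by apply/funext => x /=; rewrite /cosh mulNr mulrC.
have d1 := is_derive_expR_affine w c t; have d2 := is_derive_expR_affine (- w) c t.
by apply: is_derive_eq; rewrite /GRing.scale /= /sinh !mulNr; field.
Qed.

Lemma is_derive_continuous (f f' : R -> R) :
  (forall t, is_derive t (1 : R) f (f' t)) -> continuous f.
Proof.
by move=> df t; apply: differentiable_continuous; apply/derivable1_diffP; have [] := df t.
Qed.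

Lemma continuous_cosh w c : continuous (fun t : R => cosh (w * (t - c))).
Proof. exact: is_derive_continuous (is_derive_cosh w c). Qed.

Lemma continuous_sinh w c : continuous (fun t : R => sinh (w * (t - c))).
Proof. exact: is_derive_continuous (is_derive_sinh w c). Qed.

End Hyperbolic.

(** * Integration by parts *)

Section ProductFTC.
Context {R : realType}.
Notation mu := (@lebesgue_measure R).
Implicit Types (a b x y : R) (F G f : R -> R).

Lemma continuous_eq_itvcc a b F G : a < b -> continuous F -> continuous G ->
  (forall x, a < x < b -> F x = G x) -> forall x, a <= x <= b -> F x = G x.
Proof.
move=> ab cF cG FG x /andP[ax xb].
have [xlb|bx] := ltP x b.
  apply: (@cvg_unique _ _ (F t @[t --> x^'+])) => //.
    by apply: cvg_at_right_filter; exact: cF.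
  apply: (@cvg_trans _ (G t @[t --> x^'+])).
    apply: near_eq_cvg; near=> t; apply/esym/FG/andP; split.
      by apply: (le_lt_trans ax); near: t; exact: nbhs_right_gt.
    by near: t; exact: nbhs_right_lt.
  by apply: cvg_at_right_filter; exact: cG.
have {bx xb} -> : x = b by apply/le_anti; rewrite xb.
apply: (@cvg_unique _ _ (F t @[t --> b^'-])) => //.
  by apply: cvg_at_left_filter; exact: cF.
apply: (@cvg_trans _ (G t @[t --> b^'-])).
  apply: near_eq_cvg; near=> t; apply/esym/FG/andP; split.
    by near: t; exact: nbhs_left_gt.
  by near: t; exact: nbhs_left_lt.
by apply: cvg_at_left_filter; exact: cG.
Unshelve. all: by end_near. Qed.

(** The product [f s] is absolutely continuous, so it has its own extension [V], which equals [F s]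
    up to the endpoints by continuity. The product rule holds wherever [f] is derivable, that is
    almost everywhere. *)
Lemma ac_on_mul_FTC a b f F s s' : a < b -> ac_on `]a, b[ f ->
  continuous F -> (forall x, a < x < b -> F x = f x) ->
  (forall t, is_derive t (1 : R) s (s' t)) -> continuous s' ->
  forall x y, a <= x -> x <= y -> y <= b ->
    F y * s y - F x * s x = \int[mu]_(t in `]x, y[) (derive1 f t * s t + f t * s' t).
Proof.
move=> ab acf cF Ff ds cs' x y ax xy yb; have cs := is_derive_continuous ds.
have bnd (g : R -> R) : continuous g -> exists M, forall t, a <= t <= b -> `|g t| <= M.
  by move=> cg; apply: continuous_within_bounded_itv (ltW ab) _; exact: continuous_subspaceT.
have [MF FM] := bnd _ cF; have [Ms sM] := bnd _ cs.
have [C sC] := derive1_lipschitz (ltW ab) ds cs'.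
have acs : ac_on `]a, b[ s.
  apply: (ac_on_lipschitz (C := C)) => p q pq pqab; apply: sC => //.
    by have := pqab p; rewrite /= !in_itv/= lexx pq => /(_ isT)/andP[/ltW].
  by have := pqab q; rewrite /= !in_itv/= lexx pq => /(_ isT)/andP[_ /ltW].
have acfs : ac_on `]a, b[ (fun t => f t * s t).
  apply: (ac_on_mul (M := Num.max MF Ms)) => // t; rewrite /= in_itv/= => tab.
    rewrite -Ff// le_max FM//.
    by have /andP[/ltW -> /ltW ->] := tab.
  rewrite le_max sM ?orbT//.
  by have /andP[/ltW -> /ltW ->] := tab.
have [V [acV VE [mV _] VFTC _]] := ac_on_itvoo_FTC ab acfs.
have [_ [_ _ [mf _] _ aef]] := ac_on_itvoo_FTC ab acf.
have VFs : forall t, a <= t <= b -> V t = F t * s t.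
  apply: continuous_eq_itvcc ab _ _ _ => //.
  - exact: ac_onT_continuous.
  - by move=> t; apply: cvgM; [exact: cF|exact: cs].
  - by move=> t tab; rewrite VE// Ff.
have sub : `]x, y[ `<=` `]a, b[ by apply: subset_itv; rewrite bnd_simp.
rewrite -!VFs ?ax ?yb ?(le_trans ax xy) ?(le_trans xy yb)// VFTC//.
have mft : measurable_fun `]x, y[ f.
  apply: (eq_measurable_fun F); last first.
    by apply: measurable_funTS; exact: continuous_measurable_fun.
  by move=> t /set_mem/sub /=; rewrite in_itv/= => /Ff.
apply: ae_eq_Rintegral => //.
- exact: measurable_funS mV.
- apply: measurable_funD; apply: measurable_funM => //.
  + exact: measurable_funS mf.
  + by apply: measurable_funTS; exact: continuous_measurable_fun.
  + by apply: measurable_funTS; exact: continuous_measurable_fun.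
- apply: ae_impl aef => t df /sub /=; rewrite in_itv/= => /df {}df.
  have dfx : is_derive t (1:R) f (derive1 f t).
    by split => //; rewrite derive1E.
  have := ds t => dsx.
  rewrite derive1E (_ : (fun t => _) = f * s)//.
  rewrite derive_val /GRing.scale /=; ring.
Qed.

End ProductFTC.

(** * The real graph space and its kernels *)

Section GraphSpace.
Context {R : realType} {n : nat}.
Notation mu := (@lebesgue_measure R).
Variables alpha beta : 'I_n -> R.
Hypothesis alpha_lt_beta : forall i, alpha i < beta i.
Hypothesis beta_lt_alpha : forall i j : 'I_n, (i < j)%N -> beta i < alpha j.
Variable w : R.
Hypothesis w_gt0 : 0 < w.
Implicit Types (i j : 'I_n) (u v : R -> R) (x t : R).
Notation J := (J alpha beta).
Notation Omega := (Omega alpha beta).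

Lemma JP i t : J i t <-> alpha i < t < beta i.
Proof. by rewrite /J /= in_itv. Qed.

Lemma J_inj i j t : alpha i <= t <= beta i -> J j t -> i = j.
Proof.
move=> /andP[ai ib] /JP/andP[aj jb]; apply/val_inj; have [ij|ji|//] := ltngtP i j.
- by exfalso; move/beta_lt_alpha: ij; lra.
- by exfalso; move/beta_lt_alpha: ji; lra.
Qed.

Lemma near_J i x : J i x -> \near x, J i x.
Proof. by move=> /JP/near_itvoo; apply: filterS => t /JP. Qed.

Lemma measurable_J i : measurable (J i : set R).
Proof. exact: measurable_itv. Qed.

Lemma measurable_Omega : measurable (Omega : set R).
Proof. by apply: fin_bigcup_measurable => // i _; exact: measurable_J. Qed.

Lemma Omega_finite_measure : (mu Omega < +oo)%E.
Proof.
pose M : R := \sum_i (`|alpha i| + `|beta i|).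
have M0 : 0 <= M by apply: sumr_ge0 => i _; rewrite addr_ge0.
apply: (@le_lt_trans _ _ (mu `[- M, M])); last first.
  by rewrite lebesgue_measure_itv/=; case: ifP => _; rewrite -?EFinB ltry.
apply: le_measure; rewrite ?inE//; first exact: measurable_Omega.
move=> t [i _ /JP/andP[ai ib]]; rewrite /= in_itv/= -ler_norml.
apply: (@le_trans _ _ (`|alpha i| + `|beta i|)).
  by have := ler_norm (beta i); have := ler_norm (- alpha i); rewrite normrN ler_norml;
    have := normr_ge0 (beta i); have := normr_ge0 (alpha i); lra.
by rewrite /M (bigD1 i)//= lerDl sumr_ge0// => j _; rewrite addr_ge0.
Qed.

Lemma measurable_fun_Omega u : (forall i, measurable_fun (J i) u) ->
  measurable_fun Omega u.
Proof.
move=> mu_ _ Y mY; rewrite setI_bigcupl; apply: fin_bigcup_measurable => // i _.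
by apply: mu_ => //; exact: measurable_J.
Qed.

Lemma ae_Omega (P : R -> Prop) : (forall i, {ae mu, forall t, J i t -> P t}) ->
  {ae mu, forall t, Omega t -> P t}.
Proof.
move=> aeP; have := @filter_forall _ _ _ _ (ae_filter_ringOfSetsType mu) aeP.
by apply: ae_impl => t Pt [i _] /Pt.
Qed.

Lemma derive1_off_J u i : (forall t, J i t -> u t = 0) -> forall t, J i t -> derive1 u t = 0.
Proof.
move=> u0 t Jt; have nu : \near t, u t = cst 0 t.
  by apply: filterS (near_J Jt) => s /u0.
by have [_ ->] := near_eq_derivable1 nu; rewrite derive1E derive_cst.
Qed.

(** Vanishing off [Omega] identifies these functions with the extensions by zero of functions on the
    subtype, so that equality on the subtype is equality on the line. *)
Definition graph_fun u := [/\ forall i, ac_on (J i) u,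
  forall t, ~ Omega t -> u t = 0 &
  mu.-integrable Omega (EFin \o (fun t => derive1 u t ^+ 2))].

(* Locked: conversion should not compare the integrals. *)
Definition graph_form : (R -> R) -> (R -> R) -> R := locked (fun u v =>
  \int[mu]_(t in Omega) (u t * v t) +
  w ^- 2 * \int[mu]_(t in Omega) (derive1 u t * derive1 v t)).

Lemma graph_formE u v : graph_form u v = \int[mu]_(t in Omega) (u t * v t) +
  w ^- 2 * \int[mu]_(t in Omega) (derive1 u t * derive1 v t).
Proof. by rewrite /graph_form -lock. Qed.

Section AC.
Variable u : R -> R.
Hypothesis acu : forall i, ac_on (J i) u.

Lemma ac_derivable : {ae mu, forall t, Omega t -> derivable u t 1}.
Proof.
apply: ae_Omega => i; have [U [_ _ _ _]] := ac_on_itvoo_FTC (alpha_lt_beta i) (@acu i).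
by apply: ae_impl => t du /JP.
Qed.

Lemma ac_measurable_derive1 : measurable_fun Omega (derive1 u).
Proof.
apply: measurable_fun_Omega => i.
by have [U [_ _ [mdu _] _ _]] := ac_on_itvoo_FTC (alpha_lt_beta i) (@acu i).
Qed.

(** The continuous extension bounds [u] on each interval, there are finitely many intervals, and
    [Omega] has finite measure. *)
Lemma ac_L2 : L2 Omega u.
Proof.
have /choice[M uM] : forall i, exists M, forall t, J i t -> `|u t| <= M.
  move=> i; have [U [acU Uu _ _ _]] := ac_on_itvoo_FTC (alpha_lt_beta i) (@acu i).
  have [|M UM] := @continuous_within_bounded_itv R (alpha i) (beta i) U (ltW (alpha_lt_beta i)).
    by apply: continuous_subspaceT; exact: ac_onT_continuous.
  by exists M => t /JP /[dup] /andP[/ltW at_ /ltW tb] /Uu <-; apply: UM; rewrite at_.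
apply: (bounded_L2 (M := \sum_i `|M i|)); first exact: measurable_Omega.
- exact: Omega_finite_measure.
- apply: measurable_fun_Omega => i.
  have [U [acU Uu _ _ _]] := ac_on_itvoo_FTC (alpha_lt_beta i) (@acu i).
  apply: (eq_measurable_fun U); first by move=> t /set_mem/JP/Uu.
  by apply: measurable_funTS; apply: continuous_measurable_fun; exact: ac_onT_continuous.
- move=> t [i _ /uM uMi]; rewrite (le_trans uMi)// (le_trans (ler_norm _))//.
  by rewrite (bigD1 i)//= lerDl sumr_ge0.
Qed.

End AC.

Lemma graph_fun_L2 u : graph_fun u -> L2 Omega u /\ L2 Omega (derive1 u).
Proof.
move=> [acu _ iu]; split; first exact: ac_L2.
by split => //; exact: ac_measurable_derive1.
Qed.

Lemma graph_fun_integrable u v : graph_fun u -> graph_fun v ->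
  mu.-integrable Omega (EFin \o (fun t => u t * v t)) /\
  mu.-integrable Omega (EFin \o (fun t => derive1 u t * derive1 v t)).
Proof.
move=> /graph_fun_L2[u2 du2] /graph_fun_L2[v2 dv2].
by split; apply: L2_mul => //; exact: measurable_Omega.
Qed.

(** At a point where [u] or [v] is not derivable the default values of [derive1] need not be linear;
    hence the almost everywhere statement. *)
Lemma ae_derive1_lin u v c : (forall i, ac_on (J i) u) -> (forall i, ac_on (J i) v) ->
  {ae mu, forall t, Omega t ->
     c * derive1 u t + derive1 v t = derive1 (fun t => c * u t + v t) t}.
Proof.
move=> /ac_derivable au /ac_derivable av; apply: ae_impl (ae_and au av) => t [du dv] Ot.
have {}du : is_derive t (1 : R) u (derive1 u t).
  by split; [exact: du|rewrite derive1E].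
have {}dv : is_derive t (1 : R) v (derive1 v t).
  by split; [exact: dv|rewrite derive1E].
rewrite [RHS]derive1E (_ : (fun t => _) = c \*: u + v)//.
by rewrite derive_val.
Qed.

Lemma graph_fun_lin u v c : graph_fun u -> graph_fun v ->
  graph_fun (fun t => c * u t + v t).
Proof.
move=> gu gv; have [acu u0 _] := gu; have [acv v0 _] := gv.
have acuv : forall i, ac_on (J i) (fun t => c * u t + v t).
  by move=> i; exact: ac_on_lin.
split=> //; first by move=> t nt; rewrite u0// v0// mulr0 addr0.
have [_ du2] := graph_fun_L2 gu; have [_ dv2] := graph_fun_L2 gv.
suff [] : L2 Omega (derive1 (fun t => c * u t + v t)) by [].
apply: ae_eq_L2 (ae_derive1_lin c acu acv) _; first exact: measurable_Omega.
- exact: ac_measurable_derive1.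
- by apply: L2_lin => //; exact: measurable_Omega.
Qed.

Lemma graph_formC u v : graph_form u v = graph_form v u.
Proof.
have mulC (f g : R -> R) : \int[mu]_(t in Omega) (f t * g t) = \int[mu]_(t in Omega) (g t * f t).
  by apply: eq_Rintegral => t _; exact: mulrC.
by rewrite !graph_formE mulC (mulC (derive1 u)).
Qed.

Lemma graph_form_lin u v z c : graph_fun u -> graph_fun v -> graph_fun z ->
  graph_form (fun t => c * u t + v t) z = c * graph_form u z + graph_form v z.
Proof.
move=> gu gv gz; have mO := measurable_Omega.
have [uw duw] := graph_fun_integrable gu gz.
have [vw dvw] := graph_fun_integrable gv gz.
have [_ [mdu _]] := graph_fun_L2 gu; have [_ [mdv _]] := graph_fun_L2 gv.
have [_ [mdw _]] := graph_fun_L2 gz.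
have [_ [mduv _]] := graph_fun_L2 (graph_fun_lin c gu gv).
rewrite !graph_formE.
have -> : \int[mu]_(t in Omega) ((c * u t + v t) * z t) =
    c * \int[mu]_(t in Omega) (u t * z t) + \int[mu]_(t in Omega) (v t * z t).
  by rewrite -Rintegral_lin//; apply: eq_Rintegral => t _; ring.
have -> : \int[mu]_(t in Omega) (derive1 (fun t => c * u t + v t) t * derive1 z t) =
    c * \int[mu]_(t in Omega) (derive1 u t * derive1 z t) +
    \int[mu]_(t in Omega) (derive1 v t * derive1 z t).
  rewrite -Rintegral_lin//; apply: ae_eq_Rintegral => //.
  + exact: measurable_funM.
  + by apply: measurable_funD; [apply: measurable_funM => //; exact: measurable_funM|exact: measurable_funM].
  + have [acu _ _] := gu; have [acv _ _] := gv.
    by apply: ae_impl (ae_derive1_lin c acu acv) => t E Ot; rewrite -E//; ring.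
by rewrite !mulrDr (mulrCA (w ^- 2) c) addrACA.
Qed.

Lemma graph_form_ge0 u : 0 <= graph_form u u.
Proof.
rewrite !graph_formE addr_ge0//.
  by apply: Rintegral_ge0 => t _; rewrite -expr2 sqr_ge0.
rewrite mulr_ge0//; first by rewrite invr_ge0 sqr_ge0.
by apply: Rintegral_ge0 => t _; rewrite -expr2 sqr_ge0.
Qed.

Lemma graph_form_cauchy_schwarz u v : graph_fun u -> graph_fun v ->
  graph_form u v ^+ 2 <= graph_form u u * graph_form v v.
Proof.
move=> gu gv.
have pos c : 0 <= c ^+ 2 * graph_form u u + 2 * c * graph_form u v + graph_form v v.
  pose uv t := c * u t + v t; have guv : graph_fun uv := graph_fun_lin c gu gv.
  have E z : graph_fun z -> graph_form uv z = c * graph_form u z + graph_form v z.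
    exact: graph_form_lin.
  have := graph_form_ge0 uv.
  rewrite (E _ guv) (graph_formC u uv) (graph_formC v uv) (E _ gu) (E _ gv).
  rewrite (graph_formC v u).
  move: (graph_form u u) (graph_form u v) (graph_form v v) => p q r.
  by congr (0 <= _); ring.
move: pos (graph_form_ge0 u).
move: (graph_form u u) (graph_form u v) (graph_form v v) => p q r pos.
rewrite le_eqVlt => /predU1P[p0|p0].
  have [->|q0] := eqVneq q 0; first by rewrite -p0 mul0r expr0n.
  (* With [p = 0] the polynomial is [2 c q + r]; this [c] gives it the value -1, so [q] must be
     0. *)
  have := pos (- (r + 1) / (2 * q)); rewrite -p0 mulr0 add0r.
  rewrite (_ : 2 * _ * q = - (r + 1)); last by field.
  by lra.
(* The minimum of the polynomial. *)
have := pos (- q / p).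
rewrite (_ : _ + r = (p * r - q ^+ 2) / p); last by field; exact: lt0r_neq0.
by rewrite pmulr_lge0 ?invr_gt0// subr_ge0.
Qed.

End GraphSpace.

(** * The reproducing kernels of the real form *)

Section Kernel.
Context {R : realType} {n : nat}.
Notation mu := (@lebesgue_measure R).
Variables alpha beta : 'I_n -> R.
Hypothesis alpha_lt_beta : forall i, alpha i < beta i.
Hypothesis beta_lt_alpha : forall i j : 'I_n, (i < j)%N -> beta i < alpha j.
Variable w : R.
Hypothesis w_gt0 : 0 < w.
Implicit Types (i j : 'I_n) (u v : R -> R) (x t : R).
Notation J := (J alpha beta).
Notation Omega := (Omega alpha beta).

(** The Green function of [k - w^-2 k''] on [J j] with Neumann boundary conditions. Writing it with
    [min] and [max] lets [x] be an endpoint, where one of the two [cosh] factors becomes 1. *)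
Definition graph_kernel j x t : R := \1_(J j) t *
  (w * cosh (w * (Num.min t x - alpha j)) * cosh (w * (Num.max t x - beta j)) /
   sinh (w * (beta j - alpha j))).

Let S j := sinh (w * (beta j - alpha j)).

Let S_gt0 j : 0 < S j.
Proof. by rewrite sinh_gt0// mulr_gt0// subr_gt0. Qed.

Lemma kernel_off j x t : ~ J j t -> graph_kernel j x t = 0.
Proof. by move=> nJ; rewrite /graph_kernel indicE memNset// mul0r. Qed.

Lemma kernel_le j x t : J j t -> t <= x ->
  graph_kernel j x t = w * cosh (w * (x - beta j)) / S j * cosh (w * (t - alpha j)).
Proof.
move=> Jt tx; rewrite /graph_kernel indicE mem_set// mul1r (min_idPl tx) (max_idPr tx) -/(S j).
by rewrite (mulrAC w) [LHS]mulrAC.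
Qed.

Lemma kernel_ge j x t : J j t -> x <= t ->
  graph_kernel j x t = w * cosh (w * (x - alpha j)) / S j * cosh (w * (t - beta j)).
Proof.
move=> Jt xt; rewrite /graph_kernel indicE mem_set// mul1r (min_idPr xt) (max_idPl xt) -/(S j).
by rewrite mulrAC.
Qed.

Lemma derive1_kernel_lt j x t : J j t -> t < x -> derive1 (graph_kernel j x) t =
  w * cosh (w * (x - beta j)) / S j * (w * sinh (w * (t - alpha j))).
Proof.
move=> Jt tx; set A := _ / _.
have nu : \near t, graph_kernel j x t = A * cosh (w * (t - alpha j)).
  near=> s; apply: kernel_le; first by near: s; exact: near_J.
  by apply/ltW; near: s; exact: lt_nbhsl.
have [_ ->] := near_eq_derivable1 nu.
have ds := is_derive_cosh w (alpha j) t.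
rewrite derive1E (_ : (fun t => _) = A \*: (fun t => cosh (w * (t - alpha j))))//.
exact: derive_val.
Unshelve. all: by end_near. Qed.

Lemma derive1_kernel_gt j x t : J j t -> x < t -> derive1 (graph_kernel j x) t =
  w * cosh (w * (x - alpha j)) / S j * (w * sinh (w * (t - beta j))).
Proof.
move=> Jt xt; set A := _ / _.
have nu : \near t, graph_kernel j x t = A * cosh (w * (t - beta j)).
  near=> s; apply: kernel_ge; first by near: s; exact: near_J.
  by apply/ltW; near: s; exact: lt_nbhsr.
have [_ ->] := near_eq_derivable1 nu.
have ds := is_derive_cosh w (beta j) t.
rewrite derive1E (_ : (fun t => _) = A \*: (fun t => cosh (w * (t - beta j))))//.
exact: derive_val.
Unshelve. all: by end_near. Qed.

Lemma derive1_kernel_off j x t : ~ J j t -> Omega t -> derive1 (graph_kernel j x) t = 0.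
Proof.
move=> nJ [i _ Jt]; apply: (@derive1_off_J _ _ alpha beta _ i) => // s Js.
apply: kernel_off => Jjs; apply: nJ.
suff -> : j = i by [].
by apply: (J_inj beta_lt_alpha _ Js); move/JP: Jjs => /andP[/ltW -> /ltW ->].
Qed.

(** Both [cosh] factors are Lipschitz, as [min] and [max] with [x] do not increase distances, and
    they are bounded; the derivative is bounded on each side of [x]. *)
Lemma kernel_graph_fun j x : alpha j <= x <= beta j -> graph_fun alpha beta (graph_kernel j x).
Proof.
move=> xj; have /andP[jx xjb] := xj; have abj := alpha_lt_beta j.
have acK i : ac_on (J i) (graph_kernel j x).
  have [->|ij] := eqVneq i j; last first.
    apply: (eq_ac_on (h := cst 0)); last exact: ac_on_cst.
    move=> t /set_mem Jt; rewrite kernel_off// => Jjt; move/eqP: ij; apply.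
    by apply: (J_inj beta_lt_alpha _ Jjt); move/JP: Jt => /andP[/ltW -> /ltW ->].
  pose p t := cosh (w * (Num.min t x - alpha j)).
  pose q t := cosh (w * (Num.max t x - beta j)).
  have sub s t : `[s, t] `<=` J j -> s <= t -> alpha j <= s /\ t <= beta j.
    move=> stJ st; have /JP/andP[/ltW ? _] : J j s by apply: stJ; rewrite /= in_itv/= lexx.
    by have /JP/andP[_ /ltW ?] : J j t by apply: stJ; rewrite /= in_itv/= lexx andbT.
  have cosh_bnd c : exists M, forall t, alpha j <= t <= beta j -> `|cosh (w * (t - c))| <= M.
    apply: continuous_within_bounded_itv (ltW abj) _; apply: continuous_subspaceT.
    exact: continuous_cosh.
  have cosh_lip c : exists C, forall s t, alpha j <= s -> s <= t -> t <= beta j ->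
      `|cosh (w * (t - c)) - cosh (w * (s - c))| <= C * (t - s).
    apply: derive1_lipschitz (ltW abj) (is_derive_cosh w c) _.
    by move=> t; apply: cvgM; [exact: cvg_cst|exact: continuous_sinh].
  have C_ge0 (C : R) (f : R -> R) : (forall s t, alpha j <= s -> s <= t -> t <= beta j ->
      `|f t - f s| <= C * (t - s)) -> 0 <= C.
    move=> /(_ _ _ (lexx _) (ltW abj) (lexx _)) /(le_trans (normr_ge0 _)).
    by rewrite pmulr_lge0// subr_gt0.
  have acp : ac_on (J j) p.
    have [C /[dup] hC /C_ge0 C0] := cosh_lip (alpha j).
    apply: (ac_on_lipschitz (C := C)) => s t st /sub/(_ st)[js tj].
    have mm : Num.min s x <= Num.min t x by rewrite le_min ge_min st ge_min lexx orbT.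
    apply: (le_trans (hC _ _ _ mm _)).
    + by rewrite le_min js.
    + by rewrite ge_min tj.
    + rewrite ler_wpM2l// /Num.min; do ! case: ltP => ?; lra.
  have acq : ac_on (J j) q.
    have [C /[dup] hC /C_ge0 C0] := cosh_lip (beta j).
    apply: (ac_on_lipschitz (C := C)) => s t st /sub/(_ st)[js tj].
    have mm : Num.max s x <= Num.max t x by rewrite ge_max !le_max st lexx orbT.
    apply: (le_trans (hC _ _ _ mm _)).
    + by rewrite le_max js.
    + by rewrite ge_max tj.
    + rewrite ler_wpM2l// /Num.max; do ! case: ltP => ?; lra.
  have [Mp Hp] := cosh_bnd (alpha j); have [Mq Hq] := cosh_bnd (beta j).
  have acpq : ac_on (J j) (fun t => p t * q t).
    apply: (ac_on_mul (M := Num.max Mp Mq)) => // t /JP/andP[/ltW jt /ltW tj].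
      by rewrite le_max Hp// le_min ge_min jt jx tj.
    by rewrite le_max Hq ?orbT// le_max ge_max jt tj xjb.
  have := ac_on_lin (w / S j) acpq (ac_on_cst (J j) 0).
  apply: eq_ac_on => t /set_mem Jt; rewrite addr0 /graph_kernel indicE mem_set// mul1r -/(S j).
  by rewrite /p /q; ring.
split => //.
  by move=> t nO; apply: kernel_off => Jt; apply: nO; exists j.
have bnd c : exists M, forall t, alpha j <= t <= beta j -> `|w * sinh (w * (t - c))| <= M.
  apply: continuous_within_bounded_itv (ltW abj) _; apply: continuous_subspaceT.
  by move=> t; apply: cvgM; [exact: cvg_cst|exact: continuous_sinh].
have [M1 H1] := bnd (alpha j); have [M2 H2] := bnd (beta j).
pose A := w * cosh (w * (x - beta j)) / S j.
pose D := w * cosh (w * (x - alpha j)) / S j.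
have M10 : 0 <= M1 by apply: le_trans (H1 _ xj).
have M20 : 0 <= M2 by apply: le_trans (H2 _ xj).
have := normr_ge0 A; have := normr_ge0 D => D0 A0.
suff [] : L2 Omega (derive1 (graph_kernel j x)) by [].
(* The last summand covers the corner [t = x], whatever value [derive1] takes there. *)
apply: (bounded_L2 (M := `|A| * M1 + `|D| * M2 + `|derive1 (graph_kernel j x) x|)).
- exact: measurable_Omega.
- exact: Omega_finite_measure.
- exact: ac_measurable_derive1.
- move=> t Ot; have K0 := normr_ge0 (derive1 (graph_kernel j x) x).
  have AM : 0 <= `|A| * M1 by exact: mulr_ge0.
  have DM : 0 <= `|D| * M2 by exact: mulr_ge0.
  have [Jt|nJ] := pselect (J j t); last by rewrite derive1_kernel_off// normr0; lra.
  have tj : alpha j <= t <= beta j by move/JP: Jt => /andP[/ltW -> /ltW ->].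
  have [tx|xt|->] := ltgtP t x; last by lra.
  + rewrite derive1_kernel_lt// normrM -/A.
    by have := ler_wpM2l A0 (H1 _ tj); lra.
  + rewrite derive1_kernel_gt// normrM -/D.
    by have := ler_wpM2l D0 (H2 _ tj); lra.
Qed.

Lemma Rintegral_Omega_J j (f : R -> R) : (forall t, ~ J j t -> Omega t -> f t = 0) ->
  \int[mu]_(t in Omega) f t = \int[mu]_(t in J j) f t.
Proof.
move=> f0; have -> : \int[mu]_(t in J j) f t = \int[mu]_(t in Omega `&` J j) f t.
  congr (Rintegral _ _ _).
  by apply/seteqP; split => [t Jt|t []//]; split => //; exists j.
rewrite Rintegral_mkcondr; apply: eq_Rintegral => t /set_mem Ot.
by rewrite patchE; case: ifPn => //; rewrite notin_setE => /f0 ->.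
Qed.

Lemma graph_form_kernel j x u U : alpha j <= x <= beta j -> graph_fun alpha beta u ->
  continuous U -> (forall t, J j t -> U t = u t) ->
  graph_form alpha beta w u (graph_kernel j x) = U x.
Proof.
move=> xj gu cU Uu; have gK := kernel_graph_fun xj.
have [iuK iduK] := graph_fun_integrable alpha_lt_beta gu gK.
have mO := measurable_Omega alpha beta; have /andP[jx xjb] := xj.
pose f t := w ^- 2 * (derive1 u t * derive1 (graph_kernel j x) t) + u t * graph_kernel j x t.
have if_ : mu.-integrable (J j) (EFin \o f).
  apply: integrableS (integrable_lin (w ^- 2) mO iduK iuK) => //.
  - exact: measurable_J.
  - by move=> t Jt; exists j.
rewrite !graph_formE addrC -Rintegral_lin// (Rintegral_Omega_J (j := j)); last first.
  by move=> t nJ Ot; rewrite derive1_kernel_off// kernel_off// !mulr0 addr0.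
rewrite -/f.
pose A := w * cosh (w * (x - beta j)) / S j.
pose D := w * cosh (w * (x - alpha j)) / S j.
have acu : ac_on (J j) u by have [] := gu.
have Uu' t : alpha j < t < beta j -> U t = u t by move=> tj; apply: Uu; apply/JP.
have left : \int[mu]_(t in `]alpha j, x[) f t = U x * (A / w * sinh (w * (x - alpha j))).
  (* This function is [w^-2 k'] on the left of [x], and its derivative is [k]. It vanishes at
     [alpha j], so only the boundary term at [x] survives; the right side is symmetric. *)
  have ds t : is_derive t (1 : R) (fun t => A / w * sinh (w * (t - alpha j)))
      (A * cosh (w * (t - alpha j))).
    have d := is_derive_sinh w (alpha j) t.
    apply: (is_derive_eq (is_deriveZ (A / w) d)).
    by rewrite /GRing.scale /= mulrA divfK// gt_eqF.
  have := ac_on_mul_FTC (alpha_lt_beta j) acu cU Uu' ds _ (lexx _) jx xjb.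
  rewrite subrr mulr0 sinh0 !mulr0 subr0 => ->; last first.
    by move=> t; apply: cvgM; [exact: cvg_cst|exact: continuous_cosh].
  apply: eq_Rintegral => t /set_mem /=; rewrite in_itv/= => /andP[jt tx].
  have Jt : J j t by apply/JP; rewrite jt (lt_le_trans tx).
  rewrite /f derive1_kernel_lt// kernel_le ?(ltW tx)// -/A.
  by field; rewrite gt_eqF.
have right : \int[mu]_(t in `]x, beta j[) f t = - (U x * (D / w * sinh (w * (x - beta j)))).
  have ds t : is_derive t (1 : R) (fun t => D / w * sinh (w * (t - beta j)))
      (D * cosh (w * (t - beta j))).
    have d := is_derive_sinh w (beta j) t.
    apply: (is_derive_eq (is_deriveZ (D / w) d)).
    by rewrite /GRing.scale /= mulrA divfK// gt_eqF.
  have := ac_on_mul_FTC (alpha_lt_beta j) acu cU Uu' ds _ jx xjb (lexx _).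
  rewrite subrr mulr0 sinh0 !mulr0 sub0r => ->; last first.
    by move=> t; apply: cvgM; [exact: cvg_cst|exact: continuous_cosh].
  apply: eq_Rintegral => t /set_mem /=; rewrite in_itv/= => /andP[xt tj].
  have Jt : J j t by apply/JP; rewrite tj (le_lt_trans jx).
  rewrite /f derive1_kernel_gt// kernel_ge ?(ltW xt)// -/D.
  by field; rewrite gt_eqF.
have -> : \int[mu]_(t in J j) f t =
    \int[mu]_(t in `]alpha j, x[) f t + \int[mu]_(t in `]x, beta j[) f t.
  (* For [x = beta j] the right-hand interval is empty; otherwise splitting [J j] at [x] loses one
     point, which is negligible. *)
  move: xjb; rewrite le_eqVlt => /predU1P[->|xb].
    by rewrite [in X in _ + X]set_itvoo0 ?Rintegral_set0 ?addr0.
  rewrite -(@Rintegral_itvB _ f (BRight (alpha j)) (BLeft (beta j)) x)//.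
  rewrite (@Rintegral_itv_bndo_bndc _ (BRight (alpha j)) x f).
    by rewrite addrC subrK.
  apply: integrableS if_ => //; first exact: measurable_J.
  by apply: subset_itvl; rewrite bnd_simp ltW.
rewrite left right.
(* The two boundary terms at [x] have exactly this sum as numerator, so the normalisation by [S j]
   leaves [U x]. *)
have SE : S j = sinh (w * (x - alpha j)) * cosh (w * (x - beta j)) -
    cosh (w * (x - alpha j)) * sinh (w * (x - beta j)).
  rewrite /S (_ : w * _ = w * (x - alpha j) + - (w * (x - beta j))); last by ring.
  by rewrite sinhD /cosh /sinh opprK; field.
have S0 : S j != 0 by rewrite gt_eqF.
rewrite /A /D -mulrBr -[RHS]mulr1; congr (_ * _).
apply: (mulIf S0); rewrite mul1r [RHS]SE; field.
by rewrite S0 gt_eqF.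
Qed.

End Kernel.

(** * Completeness *)

Section L2Complete.
Context {R : realType}.
Notation mu := (@lebesgue_measure R).
Implicit Types (D : set R) (f g : R -> R).

(** From [(|f| - q)^2 >= 0] one gets [|f| <= f^2 / q + q]. The free parameter [q] makes the L1 norm
    small as soon as the L2 norm is, in place of Cauchy-Schwarz against a constant. *)
Lemma L2_integrable_norm D f : measurable D -> (mu D < +oo)%E -> L2 D f ->
  mu.-integrable D (EFin \o (fun t => `|f t|)) /\
  forall q, 0 < q -> \int[mu]_(t in D) `|f t| <=
    q^-1 * \int[mu]_(t in D) f t ^+ 2 + q * fine (mu D).
Proof.
move=> mD Dfin [mf fi]; have mnf : measurable_fun D (fun t => `|f t|).
  exact: measurableT_comp.
have cst_int (c : R) : mu.-integrable D (EFin \o (fun=> c)).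
  by apply: (bounded_integrable (M := `|c|)).
have le_q q t : 0 < q -> `|f t| <= q^-1 * f t ^+ 2 + q.
  move=> q0; rewrite -(ler_pM2l q0) mulrDr mulrA divff ?gt_eqF// mul1r.
  rewrite -(real_normK (num_real (f t))).
  have := sqr_ge0 (`|f t| - q); rewrite sqrrB.
  by have := mulr_ge0 (ltW q0) (normr_ge0 (f t)); rewrite -expr2; lra.
have bnd_int q : mu.-integrable D (EFin \o (fun t => q^-1 * f t ^+ 2 + q)).
  exact: (integrable_lin q^-1 mD fi (cst_int q)).
have nfi : mu.-integrable D (EFin \o (fun t => `|f t|)).
  apply: (le_integrableR mD mnf _ (bnd_int 1)) => t _.
  by rewrite normr_id le_q.
split=> // q q0; apply: (@le_trans _ _ (\int[mu]_(t in D) (q^-1 * f t ^+ 2 + q))).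
  by apply: le_Rintegral => // t _; exact: le_q.
by rewrite (Rintegral_lin q^-1 mD fi (cst_int q)) Rintegral_cst.
Qed.

Lemma L2_sub D f g : measurable D -> L2 D f -> L2 D g -> L2 D (fun t => f t - g t).
Proof.
move=> mD Lf Lg; have [mL iL] := L2_lin (-1) mD Lg Lf.
rewrite (_ : (fun t => _) = (fun t => -1 * g t + f t)); first by split.
by apply/funext => t; ring.
Qed.

Variables (D : set R) (f : nat -> R -> R).
Hypotheses (mD : measurable D) (Dfin : (mu D < +oo)%E).
Hypothesis fL2 : forall m, L2 D (f m).

(** Consecutive L2 distances at most [2^-(k+1)] give L1 distances that are summable, so the sum of
    the [|d k|] is integrable, hence finite almost everywhere, and the telescoping series converges
    absolutely there. *)
Lemma L2_fast_cvg (phi : nat -> nat) :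
  (forall k, \int[mu]_(t in D) (f (phi k.+1) t - f (phi k) t) ^+ 2 <= (2 ^ k.+1)%:R ^- 2) ->
  {ae mu, forall t, D t -> cvgn (fun k => f (phi k) t)}.
Proof.
move=> fast; pose d k t := f (phi k.+1) t - f (phi k) t.
have dL2 k : L2 D (d k) by exact: L2_sub.
have di k := (L2_integrable_norm mD Dfin (dL2 k)).1.
have md k : measurable_fun D (fun t => `|d k t|%:E).
  by have /integrableP[] := di k.
pose C := 1 + fine (mu D).
have C0 : 0 <= C by rewrite addr_ge0// fine_ge0.
have d_le k : (\int[mu]_(t in D) `|d k t|%:E <= (C / (2 ^ k.+1)%:R)%:E)%E.
  rewrite -[leLHS]fineK; last by apply: integrable_fin_num => //; exact: di.
  (* This [q] balances the two terms: [q^-1 q^2 + q mu(D) = C q]. *)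
  rewrite lee_fin; pose q : R := (2 ^ k.+1)%:R^-1.
  have q0 : 0 < q by rewrite invr_gt0 ltr0n expn_gt0.
  apply: le_trans ((L2_integrable_norm mD Dfin (dL2 k)).2 _ q0) _.
  rewrite /C mulrDl mul1r -/q [q * _]mulrC lerD2r.
  apply: (@le_trans _ _ (q^-1 * q ^+ 2)).
    by rewrite ler_pM2l ?invr_gt0// (le_trans (fast k))// /q exprVn.
  by rewrite expr2 mulrA mulVf ?mul1r// gt_eqF.
have sum_int : mu.-integrable D (fun t => \sum_(0 <= k <oo) `|d k t|%:E)%E.
  apply/integrableP; split; first by
    apply: ge0_emeasurable_sum; [move=> k t Dt _; rewrite lee_fin|move=> k _; exact: md].
  under eq_integral do rewrite gee0_abs ?nneseries_ge0//.
  rewrite integral_nneseries//; apply: le_lt_trans (ltry C).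
  apply: (@le_trans _ _ (\sum_(0 <= k <oo) (C / (2 ^ k.+1)%:R)%:E)%E).
    by apply: lee_nneseries => // k _ _; apply: integral_ge0 => t _; rewrite lee_fin.
  exact: epsilon_trick0.
have := @integrable_ae _ _ R mu D mD _ sum_int; apply: ae_impl => t H /H {H}.
set s := (X in X \is a fin_num) => sfin.
have cvg_norm : cvgn [normed series (d ^~ t)].
  apply: nondecreasing_is_cvgn.
    by apply: nondecreasing_series => k *; exact: normr_ge0.
  exists (fine s) => _ [m _ <-]; rewrite -lee_fin fineK// /series/= -sumEFin.
  by apply: nneseries_lim_ge => k _ _; rewrite lee_fin.
have /(normed_cvg (V := R)) cvg_s := cvg_norm.
have -> : (fun k => f (phi k) t) = (fun k => f (phi 0%N) t + series (d ^~ t) k).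
  apply/funext => k; rewrite /series/= /d.
  by rewrite (telescope_sumr (fun k => f (phi k) t))// addrC subrK.
exact: is_cvgD (is_cvg_cst _) cvg_s.
Qed.

Hypothesis f_cauchy : forall e, 0 < e -> exists N, forall p q, (N <= p)%N -> (N <= q)%N ->
  \int[mu]_(t in D) (f p t - f q t) ^+ 2 < e.

Lemma L2_complete : exists g, [/\ L2 D g,
    forall e, 0 < e -> exists N, forall p, (N <= p)%N ->
      \int[mu]_(t in D) (f p t - g t) ^+ 2 < e &
    exists2 phi : nat -> nat, (forall k, (k <= phi k)%N) &
      {ae mu, forall t, D t -> f (phi k) t @[k --> \oo] --> g t}].
Proof.
have /choice[N NP] : forall k, exists N, forall p q, (N <= p)%N -> (N <= q)%N ->
    \int[mu]_(t in D) (f p t - f q t) ^+ 2 < (2 ^ k.+1)%:R ^- 2.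
  by move=> k; apply: f_cauchy; rewrite invr_gt0 exprn_gt0// ltr0n expn_gt0.
(* The sum makes [phi] nondecreasing and at least [N k]; the added [k] makes it tend to infinity. *)
pose phi k := (\sum_(i < k.+1) N i + k)%N.
have phiS k : (phi k <= phi k.+1)%N 
  by rewrite /phi [in leqRHS]big_ord_recr/= leq_add ?leq_addr.
have phiN k : (N k <= phi k)%N 
  by rewrite /phi big_ord_recr/= (leq_trans (leq_addl _ _) (leq_addr _ _)).
have phik k : (k <= phi k)%N by rewrite /phi leq_addl.
have aecvg : {ae mu, forall t, D t -> cvgn (fun k => f (phi k) t)}.
  apply: L2_fast_cvg => k; apply/ltW/NP => //; exact: leq_trans (phiS k).
(* The upper limit is measurable without any convergence, and equals the limit wherever the
   subsequence converges. *)
pose g t := fine (limn_esup (fun k => (f (phi k) t)%:E)).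
have mg : measurable_fun D g.
  apply: measurableT_comp => //; apply: measurable_fun_limn_esup => k.
  by apply/measurable_EFinP; have [] := fL2 (phi k).
have aeg : {ae mu, forall t, D t -> f (phi k) t @[k --> \oo] --> g t}.
  apply: ae_impl aecvg => t H /H {}H; rewrite /g.
  have : (f (phi k) t)%:E @[k --> \oo] --> (limn (fun k => f (phi k) t))%:E.
    by apply: cvg_EFin => //; exact: nearW.
  by move=> /cvg_limn_einf_sup[_ ->].
have close e : 0 < e -> exists N0, forall p, (N0 <= p)%N ->
    (\int[mu]_(t in D) ((f p t - g t) ^+ 2)%:E <= e%:E)%E.
  move=> /f_cauchy[N0 N0P]; exists N0 => p Np.
  (* The shift by [N0] puts every index in the Cauchy range, so each integral of [F k] is below [e];
     Fatou's lemma then bounds the integral of the limit. *)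
  pose F k t := ((f p t - f (phi (k + N0)%N) t) ^+ 2)%:E.
  have mF k : measurable_fun D (F k).
    apply/measurable_EFinP; apply: measurable_funX; apply: measurable_funB.
      by have [] := fL2 p.
    by have [] := fL2 (phi (k + N0)%N).
  have -> : (\int[mu]_(t in D) ((f p t - g t) ^+ 2)%:E =
      \int[mu]_(t in D) limn_einf (F ^~ t))%E.
    apply: ae_eq_integral => //.
    - apply/measurable_EFinP; apply: measurable_funX; apply: measurable_funB => //.
      by have [] := fL2 p.
    - rewrite (_ : (fun t => _) = (fun t => - limn_esup (fun k => - F k t)))%E.
        apply: measurableT_comp => //; apply: measurable_fun_limn_esup => k.
        by apply: measurableT_comp => //; exact: mF.
      apply/funext => t; rewrite -limn_einfN; congr limn_einf; apply/funext => k /=.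
      by rewrite opprK.
    - apply: ae_impl aeg => t H /H {}H; apply/esym.
      have : F k t @[k --> \oo] --> ((f p t - g t) ^+ 2)%:E.
        apply: cvg_EFin; first exact: nearW.
        have Hs : f (phi (k + N0)%N) t @[k --> \oo] --> g t.
          by apply: cvg_comp (cvg_addnr N0) H.
        rewrite expr2; apply: cvgM; (apply: cvgB; [exact: cvg_cst|exact: Hs]).
      by move=> /cvg_limn_einf_sup[-> _].
  apply: le_trans (fatou mu mD mF _) _; first by move=> k t _; rewrite lee_fin sqr_ge0.
  rewrite limn_einf_lim; apply: lime_le; first exact: is_cvg_einfs.
  apply: nearW => k; apply: (@le_trans _ _ (\int[mu]_(t in D) F k t)%E).
    by apply: ereal_inf_lbound; exists k => //=.
  rewrite -[leLHS]fineK; last first.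
    apply: integrable_fin_num => //.
    by have [] := L2_sub mD (fL2 p) (fL2 (phi (k + N0)%N)).
  rewrite lee_fin ltW//; apply: N0P => //.
  by rewrite (leq_trans _ (phik _))// leq_addl.
have subL2 p : (\int[mu]_(t in D) ((f p t - g t) ^+ 2)%:E < +oo)%E ->
    L2 D (fun t => f p t - g t).
  move=> fin; have mfg : measurable_fun D (fun t => f p t - g t).
    by apply: measurable_funB => //; have [] := fL2 p.
  split=> //; apply/integrableP; split.
    by apply/measurable_EFinP; exact: measurable_funX.
  by under eq_integral do rewrite /= ger0_norm ?sqr_ge0//.
exists g; split; last by exists phi.
- have [N1 /(_ _ (leqnn _)) le1] := close 1 ltr01.
  have /subL2 L := le_lt_trans le1 (ltry _).
  have := L2_sub mD (fL2 N1) L.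
  by rewrite (_ : (fun t => _) = g)//; apply/funext => t; ring.
- move=> e e0; have e20 : 0 < e / 2 by rewrite divr_gt0.
  have [N2 le2] := close _ e20; exists N2 => p Np.
  have [mL iL] := subL2 p (le_lt_trans (le2 _ Np) (ltry _)).
  apply: (@le_lt_trans _ _ (e / 2)); last by lra.
  by rewrite -lee_fin fineK ?le2//; exact: integrable_fin_num.
Qed.

End L2Complete.

(** * Primitives of integrable functions *)

Section Primitive.
Context {R : realType}.
Notation mu := (@lebesgue_measure R).

(** Absolute continuity of the integral, applied to the union of the intervals, gives the first
    claim. Lebesgue differentiation gives the second, [h] being locally a constant plus the
    primitive of [g] from minus infinity. *)
Lemma ac_on_primitive (a b : R) (g h : R -> R) : mu.-integrable setT (EFin \o g) ->
  (forall x y, a < x -> x <= y -> y < b -> h y - h x = \int[mu]_(t in `]x, y]) g t) ->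
  ac_on `]a, b[ h /\ {ae mu, forall t, a < t < b -> derive1 h t = g t}.
Proof.
move=> gi hE; have giS (A : set R) : measurable A -> mu.-integrable A (EFin \o g).
  by move=> mA; apply: integrableS gi.
have mg : measurable_fun setT g by exact: integrableR_measurable.
have itv_in I0 (l r : I0 -> R) k : l k <= r k -> `[l k, r k] `<=` `]a, b[ -> a < l k /\ r k < b.
  move=> lr lrab; have := lrab (l k); have := lrab (r k); rewrite /= !in_itv/= !lexx lr.
  by move=> /(_ isT)/andP[_ ->] /(_ isT)/andP[-> _].
split.
- move=> e e0; have [d [d0 hd]] := integral_normr_continuous gi e0.
  exists d => // I l r lr tlr slr.
  pose F k := `]l k, r k[%classic : set R.
  pose A := \big[setU/set0]_(k <- index_enum I) F k.
  have mF k : measurable (F k) by exact: measurable_itv.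
  have mA : measurable A by apply: bigsetU_measurable.
  have tF : trivIset [set` index_enum I] F by apply: sub_trivIset tlr.
  have muA : mu A = (\sum_k (r k - l k))%:E.
    have := @ge0_integral_bigsetU _ _ R mu _ F (cst 1%E) _ mF (index_enum_uniq I) tF
      (@measurable_cst _ _ _ _ _ _) (fun _ _ => lee01).
    rewrite integral_cst// mul1e => ->; rewrite -sumEFin.
    apply: eq_bigr => k _.
    have -> : (\int[mu]_(x in F k) cst 1 x)%E = mu (F k).
      by have := integral_cst mu (mF k) 1; rewrite mul1e.
    rewrite lebesgue_measure_itv/= lte_fin.
    have [lr1 _] := lr k; move: lr1; rewrite le_eqVlt => /predU1P[->|->].
      by rewrite ltxx subrr.
    by rewrite EFinB.
  have muAd : (mu A < d%:E)%E by rewrite muA lte_fin.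
  apply: le_lt_trans (hd A mA muAd).
  have -> : \int[mu]_(t in A) `|g t| = \sum_k \int[mu]_(t in F k) `|g t|.
    rewrite /Rintegral /A (@ge0_integral_bigsetU _ _ _ mu _ F (fun t => `|g t|%:E))//.
    + rewrite -sum_fine//= => k _; apply: integrable_fin_num; first exact: mF.
      exact: (integrable_abse (giS _ (mF k))).
    + exact: index_enum_uniq.
    + apply: measurable_funTS; apply/measurable_EFinP.
      exact: (measurableT_comp _ mg).
  apply: ler_sum => k _; have [lr1 lrab] := lr k; have [al rb] := itv_in _ _ _ _ lr1 lrab.
  rewrite hE// -Rintegral_itv_bndo_bndc; last exact: giS.
  by apply: le_normr_Rintegral => //; exact: giS.
- pose H x := \int[mu]_(t in `]-oo, x]) g t.
  have HE x y : x <= y -> H y - H x = \int[mu]_(t in `]x, y]) g t.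
    by move=> xy; rewrite Rintegral_itvB//; exact: giS.
  have : {ae mu, forall x, derivable H x 1 /\ derive1 H x = g x}.
    apply: FTC1Ny; first by move=> y; exact: giS.
    exact: open_integrable_locally openT gi.
  apply: ae_impl => t [dH <-] tab.
  pose c := h t - H t.
  have nu : \near t, h t = (H \+ cst c) t.
    apply: filterS (near_itvoo tab) => s /andP[as_ sb] /=; rewrite /c; have /andP[at_ tb] := tab.
    have [st|/ltW ts] := leP s t.
      by have := HE s t st; rewrite -hE//; lra.
    by have := HE t s ts; rewrite -hE//; lra.
  have [_ ->] := near_eq_derivable1 nu.
  have dH1 : is_derive t (1 : R) H (derive1 H t) by split; [exact: dH|rewrite derive1E].
  rewrite [LHS]derive1E; apply: derive_val.
  by apply: (is_derive_eq (is_deriveD dH1 (is_derive_cst _ _ _))); rewrite addr0.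
Qed.

End Primitive.

(** * Completeness of the real graph space *)

Section GraphComplete.
Context {R : realType} {n : nat}.
Notation mu := (@lebesgue_measure R).
Variables alpha beta : 'I_n -> R.
Hypothesis alpha_lt_beta : forall i, alpha i < beta i.
Hypothesis beta_lt_alpha : forall i j : 'I_n, (i < j)%N -> beta i < alpha j.
Variable w : R.
Hypothesis w_gt0 : 0 < w.
Implicit Types (i j : 'I_n) (u v : R -> R) (x t : R).
Notation J := (J alpha beta).
Notation Omega := (Omega alpha beta).
Notation form := (graph_form alpha beta w).
Notation gfun := (graph_fun alpha beta).
Notation K := (graph_kernel alpha beta w).

Lemma graph_fun_sub u v : gfun u -> gfun v -> gfun (fun t => u t - v t).
Proof.
move=> gu gv; have := graph_fun_lin alpha_lt_beta (-1) gv gu.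
by rewrite (_ : (fun t => -1 * v t + u t) = (fun t => u t - v t))//; apply/funext => t; ring.
Qed.

Lemma graph_eval_bound j x u : J j x -> gfun u -> u x ^+ 2 <= form u u * form (K j x) (K j x).
Proof.
move=> Jx gu; have [acu _ _] := gu.
have xj : alpha j <= x <= beta j by move/JP: Jx => /andP[/ltW -> /ltW ->].
have [U [acU Uu _ _ _]] := ac_on_itvoo_FTC (alpha_lt_beta j) (acu j).
have <- : form u (K j x) = u x.
  rewrite -(Uu x); last by apply/JP.
  by apply: graph_form_kernel => //; exact: ac_onT_continuous.
by apply: graph_form_cauchy_schwarz => //; exact: kernel_graph_fun.
Qed.

Lemma graph_form_sub u v : gfun u -> gfun v ->
  form (fun t => u t - v t) (fun t => u t - v t) =
  \int[mu]_(t in Omega) (u t - v t) ^+ 2 +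
  w ^- 2 * \int[mu]_(t in Omega) (derive1 u t - derive1 v t) ^+ 2.
Proof.
move=> gu gv; have [acu _ _] := gu; have [acv _ _] := gv.
have [_ [mduv _]] := graph_fun_L2 alpha_lt_beta (graph_fun_sub gu gv).
have [_ [mdu _]] := graph_fun_L2 alpha_lt_beta gu.
have [_ [mdv _]] := graph_fun_L2 alpha_lt_beta gv.
have mO := measurable_Omega alpha beta.
rewrite !graph_formE.
have -> : \int[mu]_(t in Omega) ((u t - v t) * (u t - v t)) =
    \int[mu]_(t in Omega) (u t - v t) ^+ 2.
  by apply: eq_Rintegral => t _; rewrite expr2.
have -> // : \int[mu]_(t in Omega) (derive1 (fun t => u t - v t) t * derive1 (fun t => u t - v t) t) =
    \int[mu]_(t in Omega) (derive1 u t - derive1 v t) ^+ 2.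
apply: ae_eq_Rintegral => //.
- exact: measurable_funM.
- by apply: measurable_funX; exact: measurable_funB.
- apply: ae_impl (ae_derive1_lin alpha_lt_beta (-1) acv acu) => t E Ot.
  rewrite (_ : (fun t => u t - v t) = (fun t => -1 * v t + u t)) -?E//.
    by rewrite -expr2; congr (_ ^+ 2); ring.
  by apply/funext => s; ring.
Qed.

Lemma graph_complete (u : nat -> R -> R) : (forall m, gfun (u m)) ->
  (forall e, 0 < e -> exists N, forall p q, (N <= p)%N -> (N <= q)%N ->
     form (fun t => u p t - u q t) (fun t => u p t - u q t) < e) ->
  exists2 l, gfun l & forall e, 0 < e -> exists N, forall p, (N <= p)%N ->
     form (fun t => u p t - l t) (fun t => u p t - l t) < e.
Proof.
move=> gu u_cauchy; have mO := measurable_Omega alpha beta.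
have Ofin := Omega_finite_measure alpha beta.
have w2 : 0 < w ^- 2 by rewrite invr_gt0 exprn_gt0.
have i_ge0 (f : R -> R) : 0 <= \int[mu]_(t in Omega) f t ^+ 2.
  by apply: Rintegral_ge0 => t _; exact: sqr_ge0.
have [|e e0|l0 [[ml0 _] l0cvg [phi phik aephi]]] := @L2_complete R Omega u mO Ofin.
- by move=> m; have [] := graph_fun_L2 alpha_lt_beta (gu m).
- have [N NP] := u_cauchy _ e0; exists N => p q Np Nq; apply: le_lt_trans (NP _ _ Np Nq).
  by rewrite graph_form_sub// lerDl mulr_ge0// ltW.
have [|e e0|g [gL2 gcvg _]] := @L2_complete R Omega (fun m => derive1 (u m)) mO Ofin.
- by move=> m; have [] := graph_fun_L2 alpha_lt_beta (gu m).
(* The form carries the derivatives with weight [w^-2]. *)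
- have [|N NP] := u_cauchy (w ^- 2 * e); first by rewrite mulr_gt0.
  exists N => p q Np Nq; rewrite -(ltr_pM2l w2); apply: le_lt_trans (NP _ _ Np Nq).
  by rewrite graph_form_sub// lerDr.
have pt_cvg t : cvgn (u ^~ t).
  have [[j _ Jt]|nO] := pselect (Omega t); last first.
    have -> : u ^~ t = cst 0 by apply/funext => m; have [_ -> //] := gu m.
    exact: is_cvg_cst.
  apply: cvgn_cauchy => e e0.
  pose C := form (K j t) (K j t) + 1.
  have K0 : 0 <= form (K j t) (K j t) by exact: graph_form_ge0.
  have C0 : 0 < C by rewrite /C ltr_wpDl.
  have [|N NP] := u_cauchy (e ^+ 2 / C); first by rewrite divr_gt0// exprn_gt0.
  exists N => p q Np Nq; rewrite -(ltr_pXn2r (n := 2))// ?nnegrE ?(ltW e0)//.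
  rewrite real_normK ?num_real//.
  apply: le_lt_trans (graph_eval_bound Jt (graph_fun_sub (gu p) (gu q))) _.
  apply: (@le_lt_trans _ _ (form (fun t => u p t - u q t) (fun t => u p t - u q t) * C)).
    by rewrite ler_wpM2l ?graph_form_ge0// /C lerDl.
  by rewrite -ltr_pdivlMr//; exact: NP.
pose l t := limn (u ^~ t).
have l_cvg t : u m t @[m --> \oo] --> l t by exact: pt_cvg.
have l_off t : ~ Omega t -> l t = 0.
  move=> nO; apply/cvg_lim => //.
  have -> : u ^~ t = cst 0 by apply/funext => m; have [_ -> //] := gu m.
  exact: cvg_cst.
(* The L2 limit [l0] is determined only almost everywhere; the pointwise limit [l] is the
   representative that will be absolutely continuous. An almost everywhere convergent subsequence
   identifies them. *)
have l0E : {ae mu, forall t, Omega t -> l0 t = l t}.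
  apply: ae_impl aephi => t H /H {}H; apply: (cvg_unique _ H) => //.
  have phiy : phi k @[k --> \oo] --> \oo.
    move=> A [N _ NA]; exists N => // k /= Nk; apply: NA => /=.
    exact: leq_trans (phik k).
  exact: cvg_comp phiy (l_cvg t).
have gi : mu.-integrable Omega (EFin \o g).
  have [ngi _] := L2_integrable_norm mO Ofin gL2.
  by apply: le_integrableR ngi => //; have [] := gL2.
(* Extended by zero, [g] becomes integrable on the whole line, as [ac_on_primitive] requires. *)
pose gT := g \_ Omega.
have gTi : mu.-integrable setT (EFin \o gT).
  by move: gi; rewrite integrable_mkcond//= restrict_EFin.
have itv_sub j x y : alpha j < x -> y < beta j -> `]x, y] `<=` Omega.
  move=> ax yb t; rewrite /= in_itv/= => /andP[xt ty]; exists j => //; apply/JP.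
  by rewrite (lt_trans ax xt) (le_lt_trans ty yb).
have lE j x y : alpha j < x -> x <= y -> y < beta j ->
    l y - l x = \int[mu]_(t in `]x, y]) gT t.
  move=> ax xy yb; have sub := itv_sub _ _ _ ax yb.
  have -> : \int[mu]_(t in `]x, y]) gT t = \int[mu]_(t in `]x, y]) g t.
    by apply: eq_Rintegral => t /set_mem /sub Ot; rewrite /gT patchE mem_set.
  have : u m y - u m x @[m --> \oo] --> l y - l x by apply: cvgB.
  move=> /(cvg_unique _); apply => //.
  apply/cvgrPdist_lt => e e0.
  pose M := fine (mu Omega) + 1.
  have M0 : 0 < M by rewrite /M ltr_wpDl// fine_ge0.
  (* With this [q], both terms of the L1 bound are controlled: [q mu(Omega) <= e / 2], and an L2
     error below [q (e / 2)] contributes less than [e / 2]. *)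
  pose q := e / 2 / M.
  have q0 : 0 < q by rewrite !divr_gt0.
  have [|N NP] := gcvg (q * (e / 2)); first by rewrite mulr_gt0// divr_gt0.
  exists N => // m /= Nm; have [acu _ _] := gu m.
  have [_ du2] := graph_fun_L2 alpha_lt_beta (gu m).
  have [U [acU Uu _ UFTC _]] := ac_on_itvoo_FTC (alpha_lt_beta j) (acu j).
  have [mdu _] := du2; have dui : mu.-integrable Omega (EFin \o derive1 (u m)).
    have [ni _] := L2_integrable_norm mO Ofin du2.
    by apply: le_integrableR ni.
  have miS f : mu.-integrable Omega (EFin \o f) -> mu.-integrable `]x, y] (EFin \o f).
    by move=> fi; apply: integrableS fi.
  have -> : u m y - u m x = \int[mu]_(t in `]x, y]) derive1 (u m) t.
    rewrite -!Uu ?ax ?yb ?(le_lt_trans xy yb) ?(lt_le_trans ax xy)//.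
    rewrite UFTC ?(ltW ax) ?(ltW yb)// Rintegral_itv_bndo_bndc//.
    by apply: integrableS dui => //; apply: subset_trans sub; exact: subset_itv_oo_oc.
  rewrite distrC -RintegralB//; [|exact: miS..].
  have dL2 := L2_sub mO du2 gL2.
  have [ndi /(_ _ q0) bnd] := L2_integrable_norm mO Ofin dL2.
  have di : mu.-integrable Omega (EFin \o (fun t => derive1 (u m) t - g t)).
    by apply: le_integrableR ndi => //; have [] := dL2.
  apply: le_lt_trans (le_normr_Rintegral _ (miS _ di)) _ => //.
  apply: (@le_lt_trans _ _ (\int[mu]_(t in Omega) `|derive1 (u m) t - g t|)).
    rewrite /Rintegral fine_le//.
    + by apply: integrable_fin_num => //; exact: miS.
    + exact: integrable_fin_num.
    + apply: ge0_subset_integral => //.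
      by apply/measurable_EFinP; apply: integrableR_measurable.
  apply: le_lt_trans bnd _.
  have : q^-1 * \int[mu]_(t in Omega) (derive1 (u m) t - g t) ^+ 2 < e / 2.
    by rewrite mulrC ltr_pdivrMr// mulrC; exact: NP.
  have : q * fine (mu Omega) <= e / 2.
    by rewrite /q -mulrA ger_pMr ?divr_gt0// mulrC ler_pdivrMr// mul1r /M lerDl.
  by move=> le2 lt1; rewrite [ltRHS]splitr; exact: ltr_leD.
have prim j := ac_on_primitive gTi (@lE j).
have acl j : ac_on (J j) l := (prim j).1.
have l'E : {ae mu, forall t, Omega t -> g t = derive1 l t}.
  apply: ae_Omega => j; apply: ae_impl (prim j).2 => t H Jt.
  by rewrite H; [rewrite /gT patchE mem_set//; exists j|apply/JP].
have gl : gfun l.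
  split => //; have [_] : L2 Omega (derive1 l) => //.
  apply: ae_eq_L2 l'E gL2 => //; exact: ac_measurable_derive1.
exists l => // e e0; have [|N1 H1] := l0cvg (e / 2); first by rewrite divr_gt0.
have [|N2 H2] := gcvg (w ^+ 2 * (e / 2)); first by rewrite mulr_gt0 ?exprn_gt0// divr_gt0.
exists (maxn N1 N2) => p; rewrite geq_max => /andP[/H1 {}H1 /H2 {}H2].
have [[mup _] [mdup _]] := graph_fun_L2 alpha_lt_beta (gu p).
have [[ml _] [mdl _]] := graph_fun_L2 alpha_lt_beta gl.
rewrite graph_form_sub// [e]splitr; apply: ltrD.
- move: H1; congr (_ < _); apply: ae_eq_Rintegral => //.
  + by apply: measurable_funX; exact: measurable_funB.
  + by apply: measurable_funX; exact: measurable_funB.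
  + by apply: ae_impl l0E => t H /H ->.
- rewrite -(ltr_pM2l (exprn_gt0 2 w_gt0)) mulrA divff ?mul1r ?gt_eqF ?exprn_gt0//.
  move: H2; congr (_ < _); apply: ae_eq_Rintegral => //.
  + by apply: measurable_funX; apply: measurable_funB => //; have [] := gL2.
  + by apply: measurable_funX; exact: measurable_funB.
  + by apply: ae_impl l'E => t H /H ->.
Qed.

End GraphComplete.

(** * Complex-valued functions *)

Section ComplexGraphSpace.
Context {R : realType} {n : nat}.
Notation mu := (@lebesgue_measure R).
Variables alpha beta : 'I_n -> R.
Hypothesis alpha_lt_beta : forall i, alpha i < beta i.
Hypothesis beta_lt_alpha : forall i j : 'I_n, (i < j)%N -> beta i < alpha j.
Variable w : R.
Hypothesis wE : w = 2 * pi.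
Implicit Types (i j : 'I_n) (u v : R -> R) (x t : R).
Notation J := (J alpha beta).
Notation Omega := (Omega alpha beta).
Notation form := (graph_form alpha beta w).
Notation gfun := (graph_fun alpha beta).
Notation K := (graph_kernel alpha beta w).
Notation Dmax := (@Dmax R n alpha beta).
Notation ip := (@graph_inner R n alpha beta).
Implicit Types f g h : Omega -> R[i].

Let w_gt0 : 0 < w.
Proof. by rewrite wE mulr_gt0// pi_gt0. Qed.

Lemma extend0_val f (t : Omega) : extend0 f (val t) = f t.
Proof. by rewrite /extend0 /= oinv_set_val valK. Qed.

Lemma extend0_in f x (Ox : x \in Omega) : extend0 f x = f (SigSub Ox).
Proof. by rewrite -extend0_val SubK. Qed.

Lemma extend0_out f x : ~ Omega x -> extend0 f x = 0.
Proof.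
by move=> nO; rewrite /extend0 /= oinv_set_val insubN ?notin_setE.
Qed.

Definition re f t := complex.Re (extend0 f t).
Definition im f t := complex.Im (extend0 f t).

Lemma extend0_restrict (F : R -> R[i]) : (forall x, ~ Omega x -> F x = 0) ->
  extend0 (fun t : Omega => F (val t)) = F.
Proof.
move=> F0; apply/funext => x; have [Ox|nO] := boolP (x \in Omega).
  by rewrite extend0_in SubK.
by rewrite extend0_out ?F0//; rewrite notin_setE in nO.
Qed.

Lemma extend0_lin c f g :
  extend0 (fun s : Omega => c * f s + g s) = (fun x => c * extend0 f x + extend0 g x).
Proof.
rewrite -[RHS]extend0_restrict; last by move=> x nO; rewrite !extend0_out// mulr0 addr0.
by congr extend0; apply/funext => t; rewrite !extend0_val.
Qed.

Lemma extend0_sub f g :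
  extend0 (fun s : Omega => f s - g s) = (fun x => extend0 f x - extend0 g x).
Proof.
rewrite -[RHS]extend0_restrict; last by move=> x nO; rewrite !extend0_out// subrr.
by congr extend0; apply/funext => t; rewrite !extend0_val.
Qed.

(** The right-hand side is nested as a real combination [a u + (b v + z)], so that the linearity
    lemmas for real functions apply twice. *)
Lemma re_lin c f g : re (fun s : Omega => c * f s + g s) =
  (fun x => complex.Re c * re f x + (- complex.Im c * im f x + re g x)).
Proof.
apply/funext => x; rewrite /re /im extend0_lin.
by case: c (extend0 f x) (extend0 g x) => [c1 c2] [a1 a2] [b1 b2] /=; ring.
Qed.

Lemma im_lin c f g : im (fun s : Omega => c * f s + g s) =
  (fun x => complex.Re c * im f x + (complex.Im c * re f x + im g x)).
Proof.
apply/funext => x; rewrite /re /im extend0_lin.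
by case: c (extend0 f x) (extend0 g x) => [c1 c2] [a1 a2] [b1 b2] /=; ring.
Qed.

Lemma re_sub f g : re (fun s : Omega => f s - g s) = (fun x => re f x - re g x).
Proof.
by apply/funext => x; rewrite /re extend0_sub; case: (extend0 f x) (extend0 g x) => [? ?] [? ?].
Qed.

Lemma im_sub f g : im (fun s : Omega => f s - g s) = (fun x => im f x - im g x).
Proof.
by apply/funext => x; rewrite /im extend0_sub; case: (extend0 f x) (extend0 g x) => [? ?] [? ?].
Qed.

Lemma cmod_cderive f t : cmod (cderive (extend0 f) t) ^+ 2 =
  derive1 (re f) t ^+ 2 + derive1 (im f) t ^+ 2.
Proof. by rewrite cmodE sqr_sqrtr// addr_ge0// sqr_ge0. Qed.

Lemma DmaxP f : Dmax f <-> gfun (re f) /\ gfun (im f).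
Proof.
have mO := measurable_Omega alpha beta.
split=> [[acf [mr mi fi]]|[gr gi]].
  have acr i : ac_on (J i) (re f) by have /absolutely_continuous_on_ac[] := acf i.
  have aci i : ac_on (J i) (im f) by have /absolutely_continuous_on_ac[] := acf i.
  have fi' : mu.-integrable Omega
      (EFin \o (fun t => derive1 (re f) t ^+ 2 + derive1 (im f) t ^+ 2)).
    by apply: eq_integrable fi => // t _ /=; rewrite cmod_cderive.
  split; split => //.
  - by move=> t nO; rewrite /re extend0_out.
  - apply: le_integrableR fi' => //; first exact: measurable_funX.
    by move=> t _; rewrite ger0_norm ?sqr_ge0// lerDl sqr_ge0.
  - by move=> t nO; rewrite /im extend0_out.
  - apply: le_integrableR fi' => //; first exact: measurable_funX.
    by move=> t _; rewrite ger0_norm ?sqr_ge0// lerDr sqr_ge0.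
have [acr _ ir] := gr; have [aci _ ii] := gi.
split; first by move=> i; apply/absolutely_continuous_on_ac; split; [exact: acr|exact: aci].
have [_ [mr _]] := graph_fun_L2 alpha_lt_beta gr.
have [_ [mi _]] := graph_fun_L2 alpha_lt_beta gi.
split=> //; have := integrable_lin 1 mO ir ii.
by apply: eq_integrable => // t _ /=; rewrite cmod_cderive mul1r.
Qed.

(** Dividing by [w i] is multiplying by [- i / w]: it exchanges the real and imaginary parts up to
    sign, which cancels in the product and leaves the weight [w^-2]. *)
Lemma Dop_mul f g t : Dop f t * (Dop g t)^* =
  (w ^- 2 * (derive1 (re f) t * derive1 (re g) t + derive1 (im f) t * derive1 (im g) t)) +i*
  (w ^- 2 * (derive1 (im f) t * derive1 (re g) t - derive1 (re f) t * derive1 (im g) t)).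
Proof.
have DE h : Dop h t = (w^-1 * derive1 (im h) t) +i* (- (w^-1 * derive1 (re h) t)).
  rewrite /Dop -wE.
  have -> : (w%:C * 'i)^-1 = 0 +i* (- w^-1) :> R[i].
    apply: (@mulrI _ (w%:C * 'i)).
      rewrite unitfE mulf_neq0//; apply/eqP => -[]; first by apply/eqP; exact: lt0r_neq0.
      by move/eqP; rewrite oner_eq0.
    rewrite divff; last first.
      by rewrite mulf_neq0//; apply/eqP => -[]; [apply/eqP; exact: lt0r_neq0|move/eqP; rewrite oner_eq0].
    by apply/eqP; rewrite eq_complex /=; apply/andP; split; apply/eqP; field; exact: lt0r_neq0.
  by apply/eqP; rewrite eq_complex /=; apply/andP; split; apply/eqP; rewrite /re /im; ring.
rewrite !DE -exprVn; apply/eqP; rewrite eq_complex /=; apply/andP; split; apply/eqP; ring.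
Qed.

Lemma graph_innerE f g : Dmax f -> Dmax g -> ip f g =
  (form (re f) (re g) + form (im f) (im g)) +i* (form (im f) (re g) - form (re f) (im g)).
Proof.
move=> /DmaxP[rf jf] /DmaxP[rg jg]; have mO := measurable_Omega alpha beta.
have lin c d (p q : R -> R) : mu.-integrable Omega (EFin \o p) ->
    mu.-integrable Omega (EFin \o q) -> \int[mu]_(t in Omega) (c * (d * p t + q t)) =
    c * (d * \int[mu]_(t in Omega) p t + \int[mu]_(t in Omega) q t).
  by move=> pi qi; rewrite -Rintegral_lin// RintegralZl//; exact: integrable_lin.
have [rr drr] := graph_fun_integrable alpha_lt_beta rf rg.
have [ii dii] := graph_fun_integrable alpha_lt_beta jf jg.
have [ir dir] := graph_fun_integrable alpha_lt_beta jf rg.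
have [ri dri] := graph_fun_integrable alpha_lt_beta rf jg.
(* An opaque name for the integrals, so that [ring] treats them as atoms. *)
have [P PE] : exists P, forall u v, \int[mu]_(t in Omega) (u t * v t) = P u v by eexists.
have E u v : form u v = P u v + w ^- 2 * P (derive1 u) (derive1 v) by rewrite graph_formE -!PE.
rewrite /graph_inner /L2_inner /cintegral !E.
have -> : \int[mu]_(t in Omega) complex.Re (extend0 f t * (extend0 g t)^*) =
    1 * (1 * P (re f) (re g) + P (im f) (im g)).
  rewrite -!PE -lin//; apply: eq_Rintegral => t _; rewrite /re /im.
  by case: (extend0 f t) (extend0 g t) => [a b] [c d] /=; ring.
have -> : \int[mu]_(t in Omega) complex.Im (extend0 f t * (extend0 g t)^*) =
    1 * (-1 * P (re f) (im g) + P (im f) (re g)).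
  rewrite -!PE -lin//; apply: eq_Rintegral => t _; rewrite /re /im.
  by case: (extend0 f t) (extend0 g t) => [a b] [c d] /=; ring.
have -> : \int[mu]_(t in Omega) complex.Re (Dop f t * (Dop g t)^*) =
    w ^- 2 * (1 * P (derive1 (re f)) (derive1 (re g)) + P (derive1 (im f)) (derive1 (im g))).
  by rewrite -!PE -lin//; apply: eq_Rintegral => t _; rewrite Dop_mul /= mul1r.
have -> : \int[mu]_(t in Omega) complex.Im (Dop f t * (Dop g t)^*) =
    w ^- 2 * (-1 * P (derive1 (re f)) (derive1 (im g)) + P (derive1 (im f)) (derive1 (re g))).
  by rewrite -!PE -lin//; apply: eq_Rintegral => t _; rewrite Dop_mul /= mulN1r addrC.
by apply/eqP; rewrite eq_complex /=; apply/andP; split; apply/eqP; ring.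
Qed.

Lemma graph_fun0 : gfun (fun=> 0).
Proof.
split=> // [i|]; first exact: ac_on_cst.
apply: (eq_integrable _ _ _ _ (integrable0 mu Omega)) => // [|t _]; first exact: measurable_Omega.
by rewrite /= derive1E derive_cst expr0n.
Qed.

Lemma graph_form0 u : gfun u -> form u (fun=> 0) = 0.
Proof.
move=> gu; rewrite graph_formC; have := graph_form_lin alpha_lt_beta w (-1) gu gu gu.
rewrite (_ : (fun t => -1 * u t + u t) = fun=> 0) ?mulN1r ?addNr//.
by apply/funext => t; rewrite mulN1r addNr.
Qed.

Lemma DmaxE f : Dmax f -> gfun (re f) /\ gfun (im f). Proof. by move/DmaxP. Qed.

Lemma Dmax_subspace : is_subspace Dmax.
Proof.
have re0 : re (fun=> 0) = fun=> 0.
  by apply/funext => t; rewrite /re (@extend0_restrict (fun=> 0)).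
have im0 : im (fun=> 0) = fun=> 0.
  by apply/funext => t; rewrite /im (@extend0_restrict (fun=> 0)).
split; first by apply/DmaxP; rewrite re0 im0; split; exact: graph_fun0.
move=> c f g /DmaxE[rf jf] /DmaxE[rg jg]; apply/DmaxP; rewrite re_lin im_lin.
split.
  exact: (graph_fun_lin alpha_lt_beta _ rf (graph_fun_lin alpha_lt_beta _ jf rg)).
exact: (graph_fun_lin alpha_lt_beta _ jf (graph_fun_lin alpha_lt_beta _ rf jg)).
Qed.

Lemma Dmax_sub f g : Dmax f -> Dmax g -> Dmax (fun s => f s - g s).
Proof.
move=> Df Dg; have [_ /(_ (-1) _ _ Dg Df)] := Dmax_subspace.
by rewrite (_ : (fun s => -1 * g s + f s) = fun s => f s - g s)//;
  apply/funext => s; rewrite mulN1r addrC.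
Qed.

Lemma ip_self f : Dmax f -> ip f f = (form (re f) (re f) + form (im f) (im f))%:C.
Proof. by move=> Df; rewrite graph_innerE// (graph_formC _ _ _ (im f)) subrr. Qed.

(** Boundedness of the evaluations gives vanishing at every point of [Omega], not only almost
    everywhere. *)
Lemma graph_eval0 u : gfun u -> form u u = 0 -> u = fun=> 0.
Proof.
move=> gu u0; apply/funext => x; have [[j _ Jx]|nO] := pselect (Omega x); last first.
  by have [_ -> ] := gu.
have := graph_eval_bound alpha_lt_beta beta_lt_alpha w_gt0 Jx gu.
by rewrite u0 mul0r => ux; apply/eqP; rewrite -sqrf_eq0 eq_le ux sqr_ge0.
Qed.

Lemma graph_inner_is_inner_product : is_inner_product Dmax ip.
Proof.
have [_ Dlin] := Dmax_subspace; split.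
- move=> c f g h Df Dg Dh; have [rf jf] := DmaxE Df; have [rg jg] := DmaxE Dg.
  have [rh jh] := DmaxE Dh; rewrite (graph_innerE (Dlin c _ _ Df Dg) Dh) (graph_innerE Df Dh) (graph_innerE Dg Dh).
  have lin3 a b u v z y : gfun u -> gfun v -> gfun z -> gfun y ->
      form (fun t => a * u t + (b * v t + z t)) y = a * form u y + (b * form v y + form z y).
    move=> gu gv gz gy; have gvz := graph_fun_lin alpha_lt_beta b gv gz.
    by rewrite (graph_form_lin alpha_lt_beta w a gu gvz gy) (graph_form_lin alpha_lt_beta w b gv gz gy).
  rewrite re_lin im_lin !lin3//; case: c => c1 c2.
  move: (form (re f) (re h)) (form (im f) (im h)) (form (im f) (re h)) (form (re f) (im h)).
  move: (form (re g) (re h)) (form (im g) (im h)) (form (im g) (re h)) (form (re g) (im h)).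
  by move=> *; apply/eqP; rewrite eq_complex /=; apply/andP; split; apply/eqP; ring.
- move=> f g Df Dg; rewrite !graph_innerE//.
  rewrite (graph_formC _ _ _ (re g)) (graph_formC _ _ _ (im g) (im f)).
  rewrite (graph_formC _ _ _ (im g) (re f)) (graph_formC _ _ _ (re g)).
  move: (form (re f) (re g)) (form (im f) (im g)) (form (im f) (re g)) (form (re f) (im g)).
  by move=> *; apply/eqP; rewrite eq_complex /=; apply/andP; split; apply/eqP; ring.
- by move=> f Df; rewrite ip_self// ler0c addr_ge0// graph_form_ge0.
- move=> f Df; rewrite ip_self// => -[]; have [rf jf] := DmaxE Df.
  have := graph_form_ge0 alpha beta w (re f); have := graph_form_ge0 alpha beta w (im f).
  move=> i0 r0 /eqP; rewrite paddr_eq0// => /andP[/eqP/(graph_eval0 rf) fr0 /eqP/(graph_eval0 jf) fi0].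
  apply/funext => s; rewrite -extend0_val; apply/eqP; rewrite eq_complex /=; apply/andP.
  by split; apply/eqP; [exact: (congr1 (fun F => F (val s)) fr0)|exact: (congr1 (fun F => F (val s)) fi0)].
Qed.

Lemma ip_norm_sqr f : Dmax f ->
  ip_norm ip f = Num.sqrt (form (re f) (re f) + form (im f) (im f)).
Proof. by move=> Df; rewrite /ip_norm ip_self. Qed.

Lemma eval_bounded (s : Omega) : exists M : R, forall f, Dmax f -> cmod (f s) <= M * ip_norm ip f.
Proof.
have [j _ Js] : Omega (val s) by have := valP s; rewrite inE.
set C := form (K j (val s)) (K j (val s)).
have C0 : 0 <= C by exact: graph_form_ge0.
exists (2 * Num.sqrt C) => f Df; have [rf jf] := DmaxE Df.
have r0 := graph_form_ge0 alpha beta w (re f); have i0 := graph_form_ge0 alpha beta w (im f).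
have bnd u : gfun u -> form u u <= form (re f) (re f) + form (im f) (im f) ->
    `|u (val s)| <= Num.sqrt C * ip_norm ip f.
  move=> gu ule; rewrite ip_norm_sqr// -sqrtrM// -sqrtr_sqr ler_wsqrtr//.
  apply: le_trans (graph_eval_bound alpha_lt_beta beta_lt_alpha w_gt0 Js gu) _.
  by rewrite mulrC ler_wpM2l.
have := bnd _ rf; rewrite lerDl => /(_ i0) br.
have := bnd _ jf; rewrite lerDr => /(_ r0) bi.
rewrite -extend0_val; apply: le_trans (cmod_le_ReIm _) _.
by apply: le_trans (lerD br bi) _; rewrite -mulrA mulr_natl mulr2n.
Qed.

Lemma graph_inner_complete : is_complete Dmax ip.
Proof.
move=> u Du u_cauchy; have pos v := graph_form_ge0 alpha beta w v.
have [|e e0|lr glr lrP] := @graph_complete _ _ _ _ alpha_lt_beta beta_lt_alpha _ w_gt0 (re \o u).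
- by move=> m; have [] := DmaxE (Du m).
(* [graph_complete] is phrased with squared norms, hence the square root. *)
- have [|N NP] := u_cauchy (Num.sqrt e); first by rewrite sqrtr_gt0.
  exists N => p q Np Nq; have := NP _ _ Np Nq; rewrite ip_norm_sqr; last exact: Dmax_sub.
  rewrite ltr_sqrt// re_sub; apply: le_lt_trans.
  by rewrite lerDl.
have [|e e0|li gli liP] := @graph_complete _ _ _ _ alpha_lt_beta beta_lt_alpha _ w_gt0 (im \o u).
- by move=> m; have [] := DmaxE (Du m).
- have [|N NP] := u_cauchy (Num.sqrt e); first by rewrite sqrtr_gt0.
  exists N => p q Np Nq; have := NP _ _ Np Nq; rewrite ip_norm_sqr; last exact: Dmax_sub.
  rewrite ltr_sqrt// im_sub; apply: le_lt_trans.
  by rewrite lerDr.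
pose l (s : Omega) := lr (val s) +i* li (val s).
have lE : extend0 l = fun t => lr t +i* li t.
  apply: (@extend0_restrict (fun t => lr t +i* li t)) => t nO.
  by have [_ -> //] := glr; have [_ -> //] := gli.
have reE : re l = lr by apply/funext => t; rewrite /re lE.
have imE : im l = li by apply/funext => t; rewrite /im lE.
have Dl : Dmax l by apply/DmaxP; rewrite reE imE.
exists l => // e e0; have e20 : 0 < e ^+ 2 / 2 by rewrite divr_gt0// exprn_gt0.
have [N1 H1] := lrP _ e20; have [N2 H2] := liP _ e20.
exists (maxn N1 N2) => p; rewrite geq_max => /andP[/H1 {}H1 /H2 {}H2].
rewrite ip_norm_sqr; last exact: Dmax_sub.
rewrite -[ltRHS](ger0_norm (ltW e0)) -sqrtr_sqr ltr_sqrt ?exprn_gt0//.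
by rewrite re_sub im_sub reE imE [ltRHS]splitr; exact: ltrD.
Qed.

Lemma Dmax_RKHS : is_RKHS Dmax ip.
Proof.
split; [exact: Dmax_subspace|exact: graph_inner_is_inner_product|
  exact: graph_inner_complete|exact: eval_bounded].
Qed.

Lemma closure_Omega x : closure Omega x -> exists j, alpha j <= x <= beta j.
Proof.
pose C := \bigcup_(j : 'I_n) `[alpha j, beta j]%classic.
have cC : closed C.
  by apply: closed_bigcup => [|j _]; [exact: finite_finset|exact: itv_closed].
have OC : Omega `<=` C.
  move=> t [j _ /JP/andP[at_ tb]]; exists j => //=.
  by rewrite in_itv/= (ltW at_) (ltW tb).
move=> /(closure_subset OC) /cC [j _ /=]; rewrite in_itv/=; by exists j.
Qed.

Lemma closed_itv_inj i j x : alpha i <= x <= beta i -> alpha j <= x <= beta j -> i = j.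
Proof.
move=> /andP[ai ib] /andP[aj jb]; apply/val_inj; have [ij|ji|//] := ltngtP i j.
- by exfalso; move/beta_lt_alpha: ij; lra.
- by exfalso; move/beta_lt_alpha: ji; lra.
Qed.

Definition complex_kernel j x (s : Omega) : R[i] := (K j x (val s))%:C.

Lemma extend0_kernel j x : extend0 (complex_kernel j x) = fun t => (K j x t)%:C.
Proof.
apply: (@extend0_restrict (fun t => (K j x t)%:C)) => t nO.
by rewrite kernel_off// => Jt; apply: nO; exists j.
Qed.

(** All three branches of [closure_value] agree with the continuous extension: each limit is taken
    along a filter that converges to [x] and is concentrated on [J j]. *)
Lemma closure_valueE j x f (U V : R -> R) : alpha j <= x <= beta j ->
  continuous U -> (forall t, J j t -> U t = re f t) ->
  continuous V -> (forall t, J j t -> V t = im f t) ->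
  closure_value f x = U x +i* V x.
Proof.
move=> xj cU Ure cV Vim; have /andP[ax xb] := xj.
have climE (F : set_system R) : ProperFilter F -> F --> x -> F (J j) ->
    clim F (extend0 f) = U x +i* V x.
  move=> PF Fx FJ; rewrite /clim; congr (_ +i* _).
  - apply: cvg_lim => //; apply: cvg_trans (cvg_comp _ _ Fx (cU x)).
    by apply: near_eq_cvg; apply: filterS FJ => t /Ure.
  - apply: cvg_lim => //; apply: cvg_trans (cvg_comp _ _ Fx (cV x)).
    by apply: near_eq_cvg; apply: filterS FJ => t /Vim.
rewrite /closure_value; case: ifPn => [|nO].
  rewrite inE => -[i _ Jx]; have ij : j = i by apply: (J_inj beta_lt_alpha xj).
  by rewrite Ure ?Vim ?ij// /re /im; case: (extend0 f x).
have nJ : ~ J j x by move=> Jx; move: nO; rewrite notin_setE; apply; exists j.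
have abj := alpha_lt_beta j.
case: ifPn => [/existsP[i /eqP xi]|/existsPn na].
  (* The closed intervals are disjoint, so a left endpoint lying in [[alpha j, beta j]] is
     [alpha j]. *)
  have ij : i = j.
    by apply: (closed_itv_inj _ xj); rewrite -xi lexx xi ltW.
  have xa : x = alpha j by rewrite xi ij.
  apply: climE; first exact: cvg_within.
  near=> t; apply/JP; apply/andP; split; first by rewrite -xa; near: t; exact: nbhs_right_gt.
  by near: t; apply: nbhs_right_lt; rewrite xa.
have xbj : x = beta j.
  apply/eqP; rewrite eq_le xb leNgt; apply/negP => xb'; apply: nJ; apply/JP.
  by rewrite xb' andbT lt_neqAle eq_sym (na j).
apply: climE; first exact: cvg_within.
near=> t; apply/JP; apply/andP; split; first by near: t; apply: nbhs_left_gt; rewrite xbj.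
by rewrite -xbj; near: t; exact: nbhs_left_lt.
Unshelve. all: by end_near. Qed.

(** The kernel is real, so the inner product reduces to the real form applied separately to the real
    and imaginary parts of [f]. *)
Lemma complex_kernelP j x : alpha j <= x <= beta j -> is_kernel x (complex_kernel j x).
Proof.
move=> xj; have gK := kernel_graph_fun alpha_lt_beta beta_lt_alpha w xj.
have reK : re (complex_kernel j x) = K j x.
  by apply/funext => t; rewrite /re extend0_kernel.
have imK : im (complex_kernel j x) = fun=> 0.
  by apply/funext => t; rewrite /im extend0_kernel.
have DK : Dmax (complex_kernel j x).
  by apply/DmaxP; rewrite reK imK; split => //; exact: graph_fun0.
split=> // f Df; have [rf jf] := DmaxE Df.
have [acr _ _] := rf; have [aci _ _] := jf.
have [U [acU Ure _ _ _]] := ac_on_itvoo_FTC (alpha_lt_beta j) (acr j).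
have [V [acV Vim _ _ _]] := ac_on_itvoo_FTC (alpha_lt_beta j) (aci j).
have cU := ac_onT_continuous acU; have cV := ac_onT_continuous acV.
have {}Ure t : J j t -> U t = re f t by move/JP; exact: Ure.
have {}Vim t : J j t -> V t = im f t by move/JP; exact: Vim.
rewrite (closure_valueE xj cU Ure cV Vim) (graph_innerE Df DK) reK imK.
rewrite (graph_form0 rf) (graph_form0 jf) addr0 subr0.
have kE := graph_form_kernel alpha_lt_beta beta_lt_alpha w_gt0 xj.
by rewrite (kE _ _ rf cU Ure) (kE _ _ jf cV Vim).
Qed.

(** Both kernels have the same inner product with their difference [d], so [d] is orthogonal to
    itself. *)
Lemma is_kernel_unique x (k1 k2 : Omega -> R[i]) : is_kernel x k1 -> is_kernel x k2 -> k1 = k2.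
Proof.
move=> [D1 k1E] [D2 k2E]; have [iplin ipC _ ip0] := graph_inner_is_inner_product.
pose d s := -1 * k2 s + k1 s; have [_ Dlin] := Dmax_subspace.
have Dd : Dmax d by exact: Dlin.
have : d = fun=> 0.
  apply: ip0 => //; rewrite iplin// (ipC _ _ Dd D1) (ipC _ _ Dd D2) k1E// k2E//.
  by rewrite mulN1r addNr.
move=> d0; apply/funext => s; have := congr1 (fun F => F s) d0; rewrite /d mulN1r addrC.
by move/eqP; rewrite subr_eq0 => /eqP.
Qed.

End ComplexGraphSpace.

(** * Closed formulas for the kernels *)

Section KernelFormulas.
Context {R : realType} {n : nat}.
Variables alpha beta : 'I_n -> R.
Notation w := (2 * pi : R).
Notation K := (@complex_kernel R n alpha beta w).

Lemma coshN (a : R) : cosh (- a) = cosh a.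
Proof. by rewrite /cosh opprK addrC. Qed.

Lemma cosh_mulBC (c a b : R) : cosh (c * (a - b)) = cosh (c * (b - a)).
Proof. by rewrite -coshN -mulrN opprB. Qed.

Lemma complex_kernel_left i : K i (alpha i) = @kernel_left R n alpha beta i.
Proof.
apply/funext => s; rewrite /complex_kernel /kernel_left; congr (_%:C).
have [Js|nJ] := pselect (J alpha beta i (val s)); last first.
  by rewrite kernel_off// indicE memNset// mulr0 mul0r.
have /JP/andP[/ltW as_ _] := Js.
rewrite kernel_ge// indicE mem_set// mulr1 subrr mulr0 cosh0 mulr1 cosh_mulBC.
by rewrite mulrAC mulrA.
Qed.

Lemma complex_kernel_right i : K i (beta i) = @kernel_right R n alpha beta i.
Proof.
apply/funext => s; rewrite /complex_kernel /kernel_right; congr (_%:C).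
have [Js|nJ] := pselect (J alpha beta i (val s)); last first.
  by rewrite kernel_off// indicE memNset// mulr0 mul0r.
have /JP/andP[_ /ltW sb] := Js.
rewrite kernel_le// indicE mem_set// mulr1 subrr mulr0 cosh0 mulr1.
by rewrite mulrAC mulrA.
Qed.

(** The determinant of the system, cleared of denominators, is [sinh (w (beta_j - alpha_j))] by the
    addition formula; it is positive. *)
Lemma kernel_systemP j x AB : J alpha beta j x -> kernel_system alpha beta j x AB <->
  AB = (cosh (w * (beta j - x)) * sinh (w * (x - alpha j)) / sinh (w * (beta j - alpha j)),
        cosh (w * (x - alpha j)) * sinh (w * (beta j - x)) / sinh (w * (beta j - alpha j))).
Proof.
move=> /JP/andP[ax xb]; have w0 : 0 < w by rewrite mulr_gt0// pi_gt0.
have sa : 0 < sinh (w * (x - alpha j)) by rewrite sinh_gt0// mulr_gt0// subr_gt0.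
have sb : 0 < sinh (w * (beta j - x)) by rewrite sinh_gt0// mulr_gt0// subr_gt0.
have SE : sinh (w * (beta j - alpha j)) = sinh (w * (x - alpha j)) * cosh (w * (beta j - x)) +
    cosh (w * (x - alpha j)) * sinh (w * (beta j - x)).
  by rewrite -sinhD -mulrDr; congr (sinh (_ * _)); ring.
have S0 : 0 < sinh (w * (beta j - alpha j)).
  by rewrite sinh_gt0// mulr_gt0// subr_gt0 (lt_trans ax xb).
rewrite /kernel_system /coth; case: AB => A B /=; move: S0; rewrite SE.
move: (cosh (w * (beta j - x))) (cosh (w * (x - alpha j))) sa sb.
move: (sinh (w * (x - alpha j))) (sinh (w * (beta j - x))) => p q c d p0 q0 S0.
have pN := lt0r_neq0 p0; have qN := lt0r_neq0 q0; have SN := lt0r_neq0 S0.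
split=> [[AB1 AB0]|[-> ->]]; last by split; field; rewrite ?pN ?qN ?SN.
have E : A * d * q = B * c * p.
  have : (A * (d / p) - B * (c / q)) * (p * q) = 0 by rewrite AB0 mul0r.
  rewrite (_ : _ * _ = A * d * q - B * c * p); last by field; rewrite pN qN.
  by move/eqP; rewrite subr_eq0 => /eqP.
have BA : B = 1 - A by rewrite -AB1; ring.
have AE : A * (p * c + d * q) = c * p by rewrite mulrDr [A * (d * q)]mulrA E BA; ring.
have BE : B * (p * c + d * q) = d * q by rewrite BA mulrBl mul1r AE; ring.
by congr pair; [rewrite -AE mulfK|rewrite -[X in X / _]BE mulfK].
Qed.

Lemma complex_kernel_interior j x AB : J alpha beta j x ->
  kernel_system alpha beta j x AB -> K j x = @kernel_interior R n alpha beta j x AB.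
Proof.
move=> Jx /(kernel_systemP _ Jx) ->; have /JP/andP[ax xb] := Jx.
have w0 : 0 < w by rewrite mulr_gt0// pi_gt0.
have /lt0r_neq0 sa : 0 < sinh (w * (x - alpha j)) by rewrite sinh_gt0// mulr_gt0// subr_gt0.
have /lt0r_neq0 sb : 0 < sinh (w * (beta j - x)) by rewrite sinh_gt0// mulr_gt0// subr_gt0.
(* The [sinh] factor in the numerator of [A] or [B] cancels the denominator of its branch, leaving
   the Green function. *)
have cancel (W a b S c : R) : b != 0 -> W * a / S * c = W * (a * b / S * (c / b)).
  by move: S^-1 => T b0; field.
apply/funext => s; rewrite /complex_kernel /kernel_interior; congr (_%:C) => /=.
have inl : (val s \in `]alpha j, x]%classic) = (alpha j < val s <= x) by apply/idP/idP; rewrite inE /= in_itv.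
have inr : (val s \in `]x, beta j[%classic) = (x < val s < beta j) by apply/idP/idP; rewrite inE /= in_itv.
rewrite !indicE inl inr; have [Js|nJ] := pselect (J alpha beta j (val s)); last first.
  rewrite kernel_off//; have [sx|xs] := leP (val s) x.
    have -> : (alpha j < val s) = false.
      by apply/negP => as_; apply: nJ; apply/JP; rewrite as_ (le_lt_trans sx xb).
    by rewrite !(mulr0, mul0r, addr0).
  have -> : (val s < beta j) = false.
    by apply/negP => s_b; apply: nJ; apply/JP; rewrite s_b (lt_trans ax xs).
  by rewrite andbF !(mulr0, mul0r, addr0).
have /JP/andP[as_ s_b] := Js; rewrite as_ s_b andbT /=.
have [sx|xs] := leP (val s) x.
  rewrite kernel_le// mulr0 mul0r addr0 mulr1 (cosh_mulBC _ x).
  exact: cancel.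
rewrite kernel_ge// ?(ltW xs)// mulr0 mul0r add0r mulr1 (cosh_mulBC _ (val s)).
exact: cancel.
Qed.

End KernelFormulas.

Theorem proposition3p12 (R : realType) (n : nat) (alpha beta : 'I_n -> R)
    (n_gt0 : (0 < n)%N)
    (alpha_lt_beta : forall i : 'I_n, alpha i < beta i)
    (beta_lt_alpha : forall i j : 'I_n, (i < j)%N -> beta i < alpha j) :
  is_RKHS (@Dmax R n alpha beta) (@graph_inner R n alpha beta) /\
  exists k : R -> Omega alpha beta -> R[i],
    [/\ forall x : R, closure (Omega alpha beta) x ->
          unique (is_kernel x) (k x),
        forall i : 'I_n, k (alpha i) = @kernel_left R n alpha beta i,
        forall i : 'I_n, k (beta i) = @kernel_right R n alpha beta i &
        forall (j : 'I_n) (x : R), J alpha beta j x ->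
          (exists! AB : R * R, kernel_system alpha beta j x AB) /\
          forall AB : R * R, kernel_system alpha beta j x AB ->
            k x = @kernel_interior R n alpha beta j x AB].
Proof.
have KP := complex_kernelP alpha_lt_beta beta_lt_alpha (erefl (2 * pi : R)).
have Kuniq := is_kernel_unique alpha_lt_beta beta_lt_alpha (erefl (2 * pi : R)).
split; first exact: (Dmax_RKHS alpha_lt_beta beta_lt_alpha (erefl (2 * pi : R))).
(* Choice avoids selecting the interval that contains [x]: on the closure a kernel exists, and
   uniqueness identifies it with [complex_kernel j x]. The zero function is the default where no
   kernel exists. *)
pose k x := xget (fun=> 0) (@is_kernel R n alpha beta x).
have kP j x : alpha j <= x <= beta j -> is_kernel x (k x).
  by move=> /KP; exact: xgetI.
have kE j x : alpha j <= x <= beta j -> k x = @complex_kernel R n alpha beta (2 * pi) j x.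
  by move=> xj; apply: Kuniq (kP _ _ xj) (KP _ _ xj).
exists k; split.
- by move=> x /closure_Omega[j xj]; split; [exact: kP xj|move=> k' /(Kuniq _ _ _ (kP _ _ xj))].
- by move=> i; rewrite (kE i) ?complex_kernel_left// lexx ltW.
- by move=> i; rewrite (kE i) ?complex_kernel_right// lexx ltW.
- move=> j x Jx; split; last first.
    move=> AB /(complex_kernel_interior Jx) <-; apply: kE.
    by have /JP/andP[/ltW -> /ltW ->] := Jx.
  exists (cosh (2 * pi * (beta j - x)) * sinh (2 * pi * (x - alpha j)) / sinh (2 * pi * (beta j - alpha j)),
        cosh (2 * pi * (x - alpha j)) * sinh (2 * pi * (beta j - x)) / sinh (2 * pi * (beta j - alpha j))).
  by split; [apply/kernel_systemP|move=> AB /(kernel_systemP _ Jx) ->].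
Qed.
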